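(* Let $S$ be an inverse semigroup and $X\subseteq E(S)\times\mathcal{P}_{fin}(E(S))$. Then $\mathrm{B}_X(S)$ (as an algebra in the extended signature $(0,{}^{-1},\cdot,\setminus,\triangledown)$) is generated by the set $\{[s]\colon s\in S\}$ subject to the relations: (1) $[0]=0$; (2) $[st]=[s][t]$ for all $s,t\in S$; (3) $[e]=\bigtriangledown_{i=1}^n[e_i]$ for all $(e,\{e_1,\dots,e_n\})\in X$.
   Context: Conventions. All inverse semigroups have a zero element $0$. For an inverse semigroup $S$, $E(S)$ is its semilattice of idempotents ($e\wedge f=ef$); $\mathbf{d}(a)=a^{-1}a$, $\mathbf{r}(a)=aa^{-1}$; the natural partial order is $a\le b$ iff $a=be$ for some $e\in E(S)$; $a,b$ are compatible if $a^{-1}b$ and $ab^{-1}$ are idempotents. ''Boolean algebra'' means generalized Boolean algebra (relatively complemented distributive lattice with bottom $0$). A Boolean inverse semigroup is an inverse semigroup $S$ such that $E(S)$ is a Boolean algebra and compatible pairs have joins in the natural partial order. $\mathcal{P}_{fin}(E)$ is the set of all finite subsets of $E$. Extended signature. On a Boolean inverse semigroup $S$ define $s\setminus t=(\mathbf{r}(s)\setminus\mathbf{r}(t))\,s\,(\mathbf{d}(s)\setminus\mathbf{d}(t))$ and $s\triangledown t=(s\setminus t)\vee t$. With these operations, Boolean inverse semigroups form a variety of algebras $(S;0,{}^{-1},\cdot,\setminus,\triangledown)$ of type $(0,1,2,2,2)$, whose homomorphisms are exactly the maps preserving multiplication, $0$ and joins of compatible pairs. For pairwise compatible $a_1,\dots,a_n$,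 $\bigtriangledown_{i=1}^na_i$ is well defined and equals $\bigvee_{i=1}^na_i$ (with value $0$ for $n=0$). ''Generated by a set subject to relations'' refers to presentations in this variety, the generator $[s]$ corresponding to $\iota_{\mathrm{B}_X(S)}(s)$. The symbol $[s]$ in the relations is a formal generator. The semigroup $\mathrm{B}_X(S)$. A character of $E(S)$ is a non-zero map $\varphi\colon E(S)\to\{0,1\}$ with $\varphi(0)=0$, $\varphi(ef)=\varphi(e)\wedge\varphi(f)$; $\widehat{E(S)}$ is the space of characters with the topology of pointwise convergence. $X'$ is the smallest set containing $X$ such that $(e,\{e_1,\dots,e_n\})\in X'$ implies $(s^{-1}es,\{s^{-1}e_1s,\dots,s^{-1}e_ns\})\in X'$ for all $s\in S$; $\widehat{E(S)}_{X'}$ is the closed subset of characters with $\varphi(e)=\bigvee_i\varphi(e_i)$ for all $(e,\{e_1,\dots,e_n\})\in X'$. $S$ acts on $\widehat{E(S)}_{X'}$ by $(s\cdot\varphi)(e)=\varphi(s^{-1}es)$, defined when $\varphi(\mathbf{d}(s))=1$. $\mathcal{G}_X(S)$ is the groupoid of germs: elements $[s,\varphi]$ with $\varphi\in\widehat{E(S)}_{X'}$, $\varphi(\mathbf{d}(s))=1$, where $[s,\varphi]=[t,\varphi]$ iff $se=te$ for some $e\in E(S)$ with $\varphi(e)=1$; $[s,\varphi]$ goes from $\varphi$ to $s\cdot\varphi$ and $[s,t\cdot\varphi][t,\varphi]=[st,\varphi]$. Its topology has as basis the sets $\{[s,\varphi]:\varphi(\mathbf{d}(s))=1,\ \varphi(\mathbf{d}(s_1))=\dots=\varphi(\mathbf{d}(s_n))=0\}$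 with $n\ge0$, $s\in S$, $s_1,\dots,s_n\le s$. $\mathrm{B}_X(S)$ is the Boolean inverse semigroup of compact-open bisections of $\mathcal{G}_X(S)$ under multiplication of subsets, and $\iota_{\mathrm{B}_X(S)}(s)=\{[s,\varphi]\in\mathcal{G}_X(S):\varphi(\mathbf{d}(s))=1\}$. *)

(* Defs.v *)
From HB Require Import structures.
From mathcomp Require Import all_boot finmap.
From mathcomp Require Import boolp classical_sets filter topology.

Set Implicit Arguments.
Unset Strict Implicit.
Unset Printing Implicit Defensive.

Declare Scope isg_scope.
Delimit Scope isg_scope with isg.
Local Open Scope classical_set_scope.
Local Open Scope group_scope.
Local Open Scope isg_scope.

HB.mixin Record Semigroup_isInverse S of Semigroup S := {
  isg_zero : S;
  isg_inv : S -> S;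
  isg_mul0 : forall a : S, isg_zero * a = isg_zero;
  isg_mulr0 : forall a : S, a * isg_zero = isg_zero;
  isg_mulVK : forall a : S, a * isg_inv a * a = a;
  isg_mulKV : forall a : S, isg_inv a * a * isg_inv a = isg_inv a;
  isg_inv_uniq : forall a b : S, a * b * a = a -> b * a * b = b -> b = isg_inv a
}.

#[short(type="invSemigroupType")]
HB.structure Definition InverseSemigroup :=
  {S of Semigroup S & Semigroup_isInverse S}.

Notation "x ^*" := (isg_inv x) : isg_scope.
Notation "0" := (@isg_zero _) : isg_scope.

Record idem (S : invSemigroupType) :=
  Idem { idem_val : S ; _ : idem_val * idem_val == idem_val }.

Notation "''E' S" := (idem S) (at level 8, S at level 2, format "''E'  S").
Notation "e %:S" := (idem_val e) (at level 2, left associativity, format "e %:S") : isg_scope.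

HB.instance Definition _ (S : invSemigroupType) := [isSub for @idem_val S].
HB.instance Definition _ (S : invSemigroupType) := [Choice of 'E S by <:].

Section InverseSemigroupTheory.
Context {S : invSemigroupType}.
Implicit Types (a b s t : S) (e f : 'E S).

Lemma idemE e : e%:S * e%:S = e%:S.
Proof. by case: e => e /= /eqP. Qed.

Lemma isg_inv_idem a : a * a = a -> a^* = a.
Proof. by move=> aa; apply/esym/isg_inv_uniq; rewrite !aa. Qed.

Lemma isg_invK a : a^*^* = a.
Proof. by apply/esym/isg_inv_uniq; rewrite ?isg_mulVK ?isg_mulKV. Qed.

Let idemM_aux a b : a * a = a -> b * b = b -> a * b * (a * b) = a * b.
Proof.
move=> aa bb; set x := (a * b)^*.
have xE : b * x * a = x.
  apply: isg_inv_uniq.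
    rewrite !mulgA -(mulgA a b b) bb -(mulgA _ a a) aa.
    by have := isg_mulVK (a * b); rewrite -/x !mulgA.
  rewrite !mulgA -(mulgA (b * x) a a) aa -(mulgA _ b b) bb.
  have := congr1 (fun y => b * y * a) (isg_mulKV (a * b)).
  by rewrite -/x !mulgA.
have xx : x * x = x.
  transitivity (b * x * a * (b * x * a)); first by rewrite xE.
  rewrite -[RHS]xE; have := congr1 (fun y => b * y * a) (isg_mulKV (a * b)).
  by rewrite -/x !mulgA.
by have := isg_inv_idem xx; rewrite {1}/x isg_invK => ->.
Qed.

Lemma idemC e f : e%:S * f%:S = f%:S * e%:S.
Proof.
have ef := idemM_aux (idemE e) (idemE f).
have fe := idemM_aux (idemE f) (idemE e).
rewrite -[LHS](isg_inv_idem ef); apply/esym/isg_inv_uniq.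
  by rewrite !mulgA -(mulgA _ f%:S f%:S) idemE -(mulgA _ e%:S e%:S) idemE -[RHS]ef !mulgA.
by rewrite !mulgA -(mulgA _ e%:S e%:S) idemE -(mulgA _ f%:S f%:S) idemE -[RHS]fe !mulgA.
Qed.

Lemma idem0_subproof : (0 : S) * 0 == 0.
Proof. by rewrite isg_mul0. Qed.

Lemma idem_mul_subproof e f : (e%:S * f%:S) * (e%:S * f%:S) == e%:S * f%:S.
Proof.
by rewrite mulgA -(mulgA _ f%:S e%:S) -(idemC e f) !mulgA idemE -mulgA idemE.
Qed.

Lemma idem_dom_subproof a : (a^* * a) * (a^* * a) == a^* * a.
Proof. by rewrite mulgA isg_mulKV. Qed.

Lemma idem_ran_subproof a : (a * a^*) * (a * a^*) == a * a^*.
Proof. by rewrite mulgA isg_mulVK. Qed.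

Lemma idem_conj_subproof a e : (a^* * e%:S * a) * (a^* * e%:S * a) == a^* * e%:S * a.
Proof.
apply/eqP; rewrite !mulgA.
rewrite -(mulgA _ a a^*) -(mulgA _ e%:S (a * a^*)).
rewrite (idemC e (Idem (idem_ran_subproof a))) /= !mulgA isg_mulKV.
by rewrite -(mulgA _ e%:S e%:S) idemE.
Qed.

End InverseSemigroupTheory.

Section InverseSemigroupDefs.
Context {S : invSemigroupType}.

Definition idem0 : 'E S := Idem (idem0_subproof).
Definition idem_mul (e f : 'E S) : 'E S := Idem (idem_mul_subproof e f).
Definition dom (a : S) : 'E S := Idem (idem_dom_subproof a).
Definition ran (a : S) : 'E S := Idem (idem_ran_subproof a).
Definition idem_conj (s : S) (e : 'E S) : 'E S := Idem (idem_conj_subproof s e).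

Definition nle (a b : S) : Prop := exists e : 'E S, a = b * e%:S.

Definition is_idem (a : S) : Prop := a * a = a.

Definition compatible (a b : S) : Prop := is_idem (a^* * b) /\ is_idem (a * b^*).

Definition is_join (a b c : S) : Prop :=
  [/\ nle a c, nle b c & forall d, nle a d -> nle b d -> nle c d].

Definition idem_join (e f g : 'E S) : Prop :=
  [/\ nle e%:S g%:S, nle f%:S g%:S &
      forall h, nle e%:S h%:S -> nle f%:S h%:S -> nle g%:S h%:S].

(* In the semilattice E(S) the meet of e and f is e f. *)
Record idem_boolean : Prop := {
  idem_join_ex : forall e f, exists g, idem_join e f g;
  idem_distr : forall e f g h, idem_join f g h ->
    idem_join (idem_mul e f) (idem_mul e g) (idem_mul e h);
  idem_compl : forall e f g, nle e%:S f%:S -> nle f%:S g%:S ->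
    exists f', idem_mul f f' = e /\ idem_join f f' g
}.

End InverseSemigroupDefs.

HB.mixin Record InverseSemigroup_isBoolean S of InverseSemigroup S := {
  bis_idem_boolean : @idem_boolean S;
  bis_join_ex : forall a b : S, compatible a b -> exists c, is_join a b c
}.

#[short(type="boolInvSemigroupType")]
HB.structure Definition BooleanInverseSemigroup :=
  {S of InverseSemigroup S & InverseSemigroup_isBoolean S}.

Section ExtendedSignature.
Context {B : boolInvSemigroupType}.

(* Joins and relative complements are unique when they exist, so [xget] picks
   the only candidate. *)
Definition bis_join (a b : B) : B := xget 0 [set c | is_join a b c].

Definition idem_diff (e f : 'E B) : 'E B :=
  xget idem0 [set g | idem_mul g (idem_mul e f) = idem0 /\
                      idem_join g (idem_mul e f) e].

Definition bis_diff (s t : B) : B :=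
  (idem_diff (ran s) (ran t))%:S * s * (idem_diff (dom s) (dom t))%:S.

Definition bis_nabla (s t : B) : B := bis_join (bis_diff s t) t.

End ExtendedSignature.

(* Terms over a set of formal generators in the signature
   (0, ^-1, *, \, nabla), of type (0, 1, 2, 2, 2). *)
Inductive term (G : Type) : Type :=
  | Gen of G
  | TZero
  | TInv of term G
  | TMul of term G & term G
  | TDiff of term G & term G
  | TNabla of term G & term G.
Arguments TZero {G}.

Fixpoint eval (G : Type) (B : boolInvSemigroupType) (f : G -> B)
    (u : term G) : B :=
  match u with
  | Gen x => f x
  | TZero => 0
  | TInv u1 => (eval f u1)^*
  | TMul u1 u2 => eval f u1 * eval f u2
  | TDiff u1 u2 => bis_diff (eval f u1) (eval f u2)
  | TNabla u1 u2 => bis_nabla (eval f u1) (eval f u2)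
  end.

Record bis_hom (A B : boolInvSemigroupType) (h : A -> B) : Prop := {
  bis_hom0 : h 0 = 0;
  bis_homV : forall a, h a^* = (h a)^*;
  bis_homM : forall a b, h (a * b) = h a * h b;
  bis_homD : forall a b, h (bis_diff a b) = bis_diff (h a) (h b);
  bis_homN : forall a b, h (bis_nabla a b) = bis_nabla (h a) (h b)
}.

Definition satisfies (G : Type) (R : term G -> term G -> Prop)
    (B : boolInvSemigroupType) (f : G -> B) : Prop :=
  forall u v, R u v -> eval f u = eval f v.

(* [A], with the generator x interpreted as [i x], is the algebra presented in
   the variety of Boolean inverse semigroups by generators [G] and
   relations [R]. *)
Record presented_by (G : Type) (R : term G -> term G -> Prop)
    (A : boolInvSemigroupType) (i : G -> A) : Prop := {
  presented_sat : satisfies R i;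
  presented_gen : forall a : A, exists u : term G, eval i u = a;
  presented_univ : forall (B : boolInvSemigroupType) (f : G -> B),
    satisfies R f -> exists! h : A -> B, bis_hom h /\ forall x, h (i x) = f x
}.


Section Characters.
Context {S : invSemigroupType}.
Context (X : set ('E S * {fset 'E S})).

Inductive conj_closure : 'E S -> {fset 'E S} -> Prop :=
  | conj_closure_base e F : X (e, F) -> conj_closure e F
  | conj_closure_conj s e F : conj_closure e F ->
      conj_closure (idem_conj s e) [fset idem_conj s f | f in F]%fset.

Record character := Character {
  chr :> 'E S -> bool;
  chr_neq0 : exists e, chr e;
  chr0 : chr idem0 = false;
  chrM : forall e f, chr (idem_mul e f) = chr e && chr f;
  chrX : forall e F, conj_closure e F -> chr e = \big[orb/false]_(f <- F) chr f
}.

HB.instance Definition _ := gen_eqMixin character.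
HB.instance Definition _ := gen_choiceMixin character.

Lemma chr_ext (phi psi : character) : phi =1 psi -> phi = psi.
Proof.
case: phi psi => [p p1 p2 p3 p4] [q q1 q2 q3 q4] /= /funext pq; subst q.
by congr Character; exact: Prop_irrelevance.
Qed.

End Characters.

Section InverseSemigroupTheory2.
Context {S : invSemigroupType}.
Implicit Types (a b s t : S) (e f : 'E S).

Lemma idem_inj e f : e%:S = f%:S -> e = f.
Proof. exact: (@val_inj _ _ 'E S). Qed.

Lemma idemK a e : a * e%:S * e%:S = a * e%:S.
Proof. by rewrite -mulgA idemE. Qed.

Lemma idemAC a e f : a * e%:S * f%:S = a * f%:S * e%:S.
Proof. by rewrite -!mulgA idemC. Qed.

Lemma mul_dom a : a * (dom a)%:S = a.
Proof. by rewrite /= mulgA isg_mulVK. Qed.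

Lemma mul_conj s e : s * (idem_conj s e)%:S = e%:S * s.
Proof.
rewrite /= !mulgA; have := idemC (ran s) e; rewrite /= => ->.
by rewrite -!mulgA (mulgA s) isg_mulVK.
Qed.

Lemma idem_inv e : e%:S^* = e%:S.
Proof. by apply: isg_inv_idem; rewrite idemE. Qed.

Lemma dom_idem e : dom e%:S = e.
Proof. by apply: idem_inj; rewrite /= idem_inv idemE. Qed.

Lemma isg_invM a b : (a * b)^* = b^* * a^*.
Proof.
apply/esym/isg_inv_uniq.
  transitivity (a * ((ran b)%:S * (dom a)%:S) * b); first by rewrite /= !mulgA.
  by rewrite idemC /= !mulgA isg_mulVK -!mulgA (mulgA b) isg_mulVK.
transitivity (b^* * ((dom a)%:S * (ran b)%:S) * a^*).
  by rewrite /= !mulgA.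
by rewrite idemC /= !mulgA isg_mulKV -!mulgA (mulgA a^*) isg_mulKV.
Qed.

Lemma idem_conjM s t e : idem_conj (s * t) e = idem_conj t (idem_conj s e).
Proof. by apply: idem_inj; rewrite /= isg_invM !mulgA. Qed.

Lemma dom_mul s t : dom (s * t) = idem_conj t (dom s).
Proof. by apply: idem_inj; rewrite /= isg_invM !mulgA. Qed.

Lemma idem_conj_ran s : idem_conj s (ran s) = dom s.
Proof. by apply: idem_inj; rewrite /= !mulgA isg_mulKV. Qed.

Lemma idem_conj0 s : idem_conj s idem0 = idem0.
Proof. by apply: idem_inj; rewrite /= isg_mulr0 isg_mul0. Qed.

Lemma idem_conj_mul s e f :
  idem_conj s (idem_mul e f) = idem_mul (idem_conj s e) (idem_conj s f).
Proof.
apply: idem_inj; transitivity (s^* * (e%:S * (ran s)%:S) * f%:S * s).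
  by rewrite idemC /= !mulgA isg_mulKV.
by rewrite /= !mulgA.
Qed.

Lemma idem_conj_idem e f : idem_conj e%:S f = idem_mul e f.
Proof.
by apply: idem_inj; rewrite /= idem_inv -mulgA (idemC f e) mulgA idemE.
Qed.

Lemma idem_conjV s e :
  idem_conj s (idem_conj s^* e) = idem_mul e (dom s).
Proof.
apply: idem_inj; transitivity ((dom s)%:S * e%:S * (dom s)%:S).
  by rewrite /= isg_invK !mulgA.
by rewrite idemC -mulgA idemE.
Qed.

Lemma dom_restr s e : dom (s * e%:S) = idem_mul e (dom s).
Proof. by rewrite dom_mul idem_conj_idem. Qed.

End InverseSemigroupTheory2.

Section Groupoid.
Context {S : invSemigroupType} (X : set ('E S * {fset 'E S})).
Notation character := (character X).
Implicit Types (s t r : S) (e f : 'E S) (phi psi : character).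

Section Action.
Context (s : S) (phi : character) (sphi : phi (dom s)).

Lemma act_neq0_subproof : exists e, phi (idem_conj s e).
Proof. by exists (ran s); rewrite idem_conj_ran. Qed.

Lemma act0_subproof : phi (idem_conj s idem0) = false.
Proof. by rewrite idem_conj0 chr0. Qed.

Lemma actM_subproof e f : phi (idem_conj s (idem_mul e f)) =
  phi (idem_conj s e) && phi (idem_conj s f).
Proof. by rewrite idem_conj_mul chrM. Qed.

Lemma actX_subproof e (F : {fset 'E S}) : conj_closure X e F ->
  phi (idem_conj s e) = \big[orb/false]_(f <- F) phi (idem_conj s f).
Proof.
move=> /(conj_closure_conj s)/(chrX phi) ->; rewrite !big_has.
apply/hasP/hasP => [[_ /imfsetP[f /= fF ->] pf]|[f fF pf]]; first by exists f.
by exists (idem_conj s f) => //; apply/imfsetP; exists f.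
Qed.

Definition act : character :=
  Character act_neq0_subproof act0_subproof actM_subproof actX_subproof.

End Action.

Definition germ_eq phi s t : Prop :=
  exists e, phi e /\ s * e%:S = t * e%:S.

Lemma germ_eq_refl phi s : germ_eq phi s s.
Proof. by have [e pe] := chr_neq0 phi; exists e. Qed.

Lemma germ_eq_sym phi s t : germ_eq phi s t -> germ_eq phi t s.
Proof. by case=> e [pe ste]; exists e. Qed.

Lemma germ_eq_trans phi s t r :
  germ_eq phi s t -> germ_eq phi t r -> germ_eq phi s r.
Proof.
move=> [e [pe ste]] [f [pf trf]]; exists (idem_mul e f); split.
  by rewrite chrM pe.
by rewrite /= !mulgA ste idemAC trf idemAC.
Qed.

Definition pregerm := {p : S * character | p.2 (dom p.1)}.

Definition pregerm_rel (p q : pregerm) : bool :=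
  `[< (val p).2 = (val q).2 /\ germ_eq (val p).2 (val p).1 (val q).1 >].

Lemma pregerm_rel_refl : reflexive pregerm_rel.
Proof. by move=> p; apply/asboolP; split=> //; exact: germ_eq_refl. Qed.

Lemma pregerm_rel_sym : symmetric pregerm_rel.
Proof.
suff sub p q : pregerm_rel p q -> pregerm_rel q p.
  by move=> p q; apply/idP/idP; exact: sub.
by move=> /asboolP[pq /germ_eq_sym]; rewrite pq => h; apply/asboolP.
Qed.

Lemma pregerm_rel_trans : transitive pregerm_rel.
Proof.
move=> q p r /asboolP[pq h] /asboolP[qr k]; apply/asboolP.
by split; [rewrite pq|move: k; rewrite -pq; exact: germ_eq_trans].
Qed.

Canonical pregerm_equiv :=
  EquivRel pregerm_rel pregerm_rel_refl pregerm_rel_sym pregerm_rel_trans.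

Definition groupoid := {eq_quot pregerm_equiv}%qT.

HB.instance Definition _ := EqQuotient.on groupoid.
HB.instance Definition _ := Choice.on groupoid.

Definition germ s phi (sphi : phi (dom s)) : groupoid :=
  (\pi_groupoid)%qT (exist (fun p : S * character => p.2 (dom p.1)) (s, phi) sphi).

(* [tgt] does not depend on the representative: see [tgt_germ] below. *)
Definition src (g : groupoid) : character := (val (repr g)).2.
Definition tgt (g : groupoid) : character := act (valP (repr g)).

Lemma comp_subproof s t phi (tphi : phi (dom t)) (sphi : act tphi (dom s)) :
  phi (dom (s * t)).
Proof. by rewrite dom_mul. Qed.

Lemma inv_subproof s phi (sphi : phi (dom s)) : act sphi (dom s^*).
Proof.
suff -> : dom s^* = ran s by rewrite /= idem_conj_ran.
by apply: idem_inj; rewrite /= isg_invK.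
Qed.

Inductive germ_comp : groupoid -> groupoid -> groupoid -> Prop :=
  GermComp s t phi (tphi : phi (dom t)) (sphi : act tphi (dom s)) :
    germ_comp (germ sphi) (germ tphi) (germ (comp_subproof sphi)).

Inductive germ_inv : groupoid -> groupoid -> Prop :=
  GermInv s phi (sphi : phi (dom s)) :
    germ_inv (germ sphi) (germ (inv_subproof sphi)).

Definition basic_open s (l : seq S) : set groupoid :=
  [set g | exists phi (sphi : phi (dom s)), g = germ sphi /\
           forall t, t \in l -> phi (dom t) = false].

Definition basis_sets : set (set groupoid) :=
  [set U | exists s l, (forall t, t \in l -> nle t s) /\ U = basic_open s l].

Lemma germP s t phi (sphi : phi (dom s)) (tphi : phi (dom t)) :
  germ sphi = germ tphi <-> germ_eq phi s t.
Proof.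
split; first by move=> /eqmodP/asboolP[].
by move=> h; apply/eqmodP/asboolP.
Qed.

Lemma germ_chr s t phi psi (sphi : phi (dom s)) (tpsi : psi (dom t)) :
  germ sphi = germ tpsi -> phi = psi.
Proof. by move=> /eqmodP/asboolP[]. Qed.

Lemma groupoid_ind (P : groupoid -> Prop) :
  (forall s phi (sphi : phi (dom s)), P (germ sphi)) -> forall g, P g.
Proof. by move=> h; elim/quotW=> -[[s phi] sphi]; exact: h. Qed.

Lemma germ_eq_dom phi s t : germ_eq phi s t -> phi (dom s) -> phi (dom t).
Proof.
move=> [e [pe /(congr1 dom)]]; rewrite !dom_restr => /(congr1 phi).
by rewrite !chrM pe /= => ->.
Qed.

(* The germ [s, phi] exists and belongs to [U]. *)
Definition mem (U : set groupoid) s phi := exists h : phi (dom s), U (germ h).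

Lemma memE U s phi (h : phi (dom s)) : U (germ h) <-> mem U s phi.
Proof.
split; first by exists h.
by case=> h1; rewrite (Prop_irrelevance h h1).
Qed.

Lemma mem_ext U V : (forall s phi, mem U s phi <-> mem V s phi) -> U = V.
Proof.
move=> h; apply/seteqP; split; elim/groupoid_ind=> s phi sphi.
  by rewrite !memE => /h.
by rewrite !memE => /h.
Qed.

Lemma mem_sub U V : (forall s phi, mem U s phi -> mem V s phi) <-> U `<=` V.
Proof.
split=> [h|UV s phi [sphi /UV]]; last by exists sphi.
by elim/groupoid_ind=> s phi sphi; rewrite !memE => /h.
Qed.

Lemma mem_eq U s t phi : germ_eq phi s t -> mem U s phi -> mem U t phi.
Proof.
move=> st [h Uh]; have h' := germ_eq_dom st h; exists h'.
by rewrite -((germP h h').2 st).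
Qed.

Lemma mem_dom U s phi : mem U s phi -> phi (dom s).
Proof. by case. Qed.

Lemma mem_basic s l r phi : mem (basic_open s l) r phi <->
  [/\ phi (dom s), forall t, t \in l -> phi (dom t) = false & germ_eq phi r s].
Proof.
split=> [[rphi [psi [spsi [E lpsi]]]]|[sphi lphi rs]].
  have ? := germ_chr E; subst psi; split=> //.
  by apply/germP; exact: E.
have rphi := germ_eq_dom (germ_eq_sym rs) sphi; exists rphi.
by exists phi, sphi; split=> //; apply/germP.
Qed.

Lemma basic_cover : \bigcup_(U in basis_sets) U = setT.
Proof.
apply/seteqP; split=> // + _; elim/groupoid_ind=> s phi sphi.
exists (basic_open s [::]); first by exists s, [::].
by rewrite memE mem_basic; split=> //; exact: germ_eq_refl.
Qed.


Lemma src_germ s phi (sphi : phi (dom s)) : src (germ sphi) = phi.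
Proof.
rewrite /src; move: (reprK (germ sphi)); case: (repr _) => [[t psi] tpsi] /= E.
exact: (@germ_chr t s psi phi tpsi sphi).
Qed.

Lemma germ_eq_restr phi s e : phi e -> germ_eq phi s (s * e%:S).
Proof. by move=> pe; exists e; rewrite idemK. Qed.

Lemma basic_join U V g : basis_sets U -> basis_sets V -> U g -> V g ->
  exists W, [/\ basis_sets W, W g & W `<=` U `&` V].
Proof.
move=> [s [l [ls ->]]] [t [m [mt ->]]]; elim/groupoid_ind: g => r phi rphi.
rewrite !memE !mem_basic => -[sphi lphi rs] [tphi mphi rt].
have [e [pe ste]] := germ_eq_trans (germ_eq_sym rs) rt.
exists (basic_open (s * e%:S) [seq x * e%:S | x <- l ++ m]); split.
- eexists; eexists; split=> // _ /mapP[x + ->]; rewrite mem_cat => /orP[].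
  by move=> /ls[f ->]; exists f; rewrite idemAC.
  by move=> /mt[f ->]; exists f; rewrite ste idemAC.
- rewrite memE mem_basic; split.
  + by rewrite dom_restr chrM pe.
  + move=> _ /mapP[x xlm ->]; rewrite dom_restr chrM; apply/negbTE.
    rewrite negb_and; apply/orP; right; apply/negbT.
    by move: xlm; rewrite mem_cat => /orP[/lphi|/mphi].
  + exact: germ_eq_trans rs (germ_eq_restr _ pe).
apply/mem_sub => q psi /mem_basic[]; rewrite dom_restr chrM => /andP[qe qs] lm qse.
have lm' x : x \in l ++ m -> psi (dom x) = false.
  by move=> xlm; move: (lm (x * e%:S)); rewrite dom_restr chrM qe; apply; exact: (map_f (fun x => x * e%:S)).
have qs' := germ_eq_trans qse (germ_eq_sym (germ_eq_restr s qe)).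
have qt' : germ_eq psi q t.
  by move: qse; rewrite ste => /germ_eq_trans; apply; exact/germ_eq_sym/germ_eq_restr.
have [h _] : mem setT q psi.
  by exists (germ_eq_dom (germ_eq_sym qs') qs).
exists h; split; rewrite memE mem_basic; split=> //.
- by move=> x xl; apply: lm'; rewrite mem_cat xl.
- exact: germ_eq_dom qt' h.
- by move=> x xm; apply: lm'; rewrite mem_cat xm orbT.
Qed.

HB.instance Definition _ := isBaseTopological.Build groupoid
  basic_cover basic_join.

Lemma openP (U : set groupoid) : open U <-> forall r phi, mem U r phi ->
  exists s l, [/\ forall t, t \in l -> nle t s, mem (basic_open s l) r phi &
    basic_open s l `<=` U].
Proof.
split=> [[D DB <-] r phi [rphi [W DW Wr]]|H].
  have [s [l [ls E]]] := DB _ DW; exists s, l; split=> //.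
    by rewrite -E; exists rphi.
  by rewrite -E => g Wg; exists W.
exists [set W | basis_sets W /\ W `<=` U]; first by move=> W [].
apply/seteqP; split=> [g [W [_ WU] /WU]//|].
elim/groupoid_ind=> s phi sphi; rewrite memE => /H[t [l [lt stl tU]]].
by exists (basic_open t l); [split=> //; exists t, l|rewrite memE].
Qed.

Lemma open_basic s l : (forall t, t \in l -> nle t s) -> open (basic_open s l).
Proof. by move=> ls; apply/openP => r phi rm; exists s, l; split. Qed.

Lemma compact_basic s l : compact (basic_open s l).
Proof.
rewrite compact_ultra => F FU Fs.
pose D e : set groupoid := [set g | src g e].
pose chi e := `[< F (D e) >].
have FI A B : F (A `&` B) <-> F A /\ F B.
  by split=> [FAB|[]]; [split; apply: filterS FAB => ? []|exact: filterI].
have chi_s : chi (dom s).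
  apply/asboolP; apply: filterS Fs; elim/groupoid_ind=> r phi rphi.
  by rewrite memE mem_basic /D /= src_germ => -[].
have chi_neq0 : exists e, chi e by exists (dom s).
have chi0 : chi idem0 = false.
  apply/asboolP; rewrite (_ : D _ = set0); first exact: filter_not_empty.
  by apply/seteqP; split=> // g; rewrite /D /= chr0.
have chiM e f : chi (idem_mul e f) = chi e && chi f.
  rewrite /chi -asbool_and; congr asbool; apply/propext; rewrite -FI.
  suff -> : D (idem_mul e f) = D e `&` D f by [].
  by apply/seteqP; split=> g; rewrite /D /= chrM => /andP.
have chiX e (E : {fset 'E S}) : conj_closure X e E ->
    chi e = \big[orb/false]_(f <- E) chi f.
  move=> eE; rewrite big_has; have DE g : D e g <-> has (fun f => src g f) E.
    by rewrite /D /= (chrX _ eE) big_has.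
  apply/asboolP/hasP => [Fe|[f fE /asboolP]]; last first.
    by apply: filterS => g Dfg; apply/DE/hasP; exists f.
  have : F [set g | has (fun f => src g f) E] by apply: filterS Fe => g /DE.
  elim: (E : seq _) => [|f r IH] /=.
    by rewrite (_ : [set _ | _] = set0) ?predeqE// => /filter_not_empty.
  move=> Ffr; case: (in_ultra_setVsetC (D f) FU) => [Ff|Fnf].
    by exists f; [rewrite mem_head|exact/asboolP].
  have [|x xr cx] := IH; last by exists x => //; rewrite inE xr orbT.
  apply: filterS (filterI Ffr Fnf) => g [/= + nf].
  by case/orP => // /nf.
pose phi := Character chi_neq0 chi0 chiM chiX.
have lphi t : t \in l -> phi (dom t) = false.
  move=> tl; apply/asboolP => Ft; apply: (@filter_not_empty _ F).
  apply: filterS (filterI Fs Ft); elim/groupoid_ind=> r psi rpsi [].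
  by rewrite memE mem_basic /D /= src_germ => -[_ /(_ _ tl) ->].
exists (@germ s phi chi_s); split.
  by rewrite memE mem_basic; split=> //; exact: germ_eq_refl.
move=> A /=; rewrite nbhsE => -[B [oB Bs] BA]; apply: filterS BA _.
move: Bs oB; rewrite memE => Bs /openP/(_ _ _ Bs)[t [m [mt]]].
rewrite mem_basic => -[tphi mphi [e [pe ste]]] tB.
apply: filterS tB _.
have Fm : F [set g | forall x, x \in m -> src g (dom x) = false].
  elim: m mphi {mt} => [|x m IH] xm; first by apply: filterS filterT.
  have Fx : F (~` D (dom x)).
    case: (in_ultra_setVsetC (D (dom x)) FU) => // Fx.
    by have := xm x (mem_head _ _); rewrite /= /chi asboolT.
  have /IH Fm : forall y, y \in m -> phi (dom y) = false.
    by move=> y ym; apply: xm; rewrite inE ym orbT.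
  apply: filterS (filterI Fx Fm) => g [/= nx gm] y; rewrite inE => /orP[/eqP->|/gm//].
  exact/negbTE/negP.
have Fe : F (D e) by exact/asboolP.
have Ft : F (D (dom t)) by exact/asboolP.
apply: filterS (filterI (filterI Fs Fm) (filterI Fe Ft)).
elim/groupoid_ind=> r psi rpsi [[]]; rewrite /D /= src_germ !memE !mem_basic.
move=> [_ _ rs] gm [psie psit]; split=> //.
by apply: germ_eq_trans rs _; exists e.
Qed.

Definition fin_basic (U : set groupoid) := exists L : seq (S * seq S),
  (forall p, p \in L -> forall t, t \in p.2 -> nle t p.1) /\
  U = [set g | exists2 p, p \in L & basic_open p.1 p.2 g].

Lemma fin_basicP U : fin_basic U <-> open U /\ compact U.
Proof.
split=> [[L [LS ->]]|[oU]].
  split.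
    apply/openP => r phi [h [p pL pr]]; exists p.1, p.2; split.
    - exact: LS.
    - by exists h.
    - by move=> g pg; exists p.
  elim: L {LS} => [|p L IH].
    rewrite (_ : [set _ | _] = set0); first exact: compact0.
    by apply/seteqP; split=> // g [].
  rewrite (_ : [set _ | _] = basic_open p.1 p.2 `|`
    [set g | exists2 p, p \in L & basic_open p.1 p.2 g]).
    by apply: compactU => //; exact: compact_basic.
  apply/seteqP; split=> [g [q]|g [pg|[q qL qg]]].
  - by rewrite inE => /orP[/eqP->|qL qg]; [left|right; exists q].
  - by exists p => //; rewrite mem_head.
  - by exists q => //; rewrite inE qL orbT.
have [->|/set0P[g0 _]] := eqVneq U set0.
  by move=> _; exists [::]; split=> //; apply/seteqP; split=> // g [].
pose G : ptopologicalType := HB.pack groupoid (isPointed.Build groupoid g0).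
rewrite [X in X _ -> _](@compact_cover G) => /(_ _ [set p : S * seq S |
  (forall t, t \in p.2 -> nle t p.1) /\ basic_open p.1 p.2 `<=` U]
  (fun p => basic_open p.1 p.2)) [].
- by move=> p [+ _]; exact: open_basic.
- elim/groupoid_ind=> r phi rphi; rewrite memE => Ur.
  have [s [l [ls rsl sU]]] := (openP U).1 oU _ _ Ur.
  by exists (s, l) => //=; rewrite memE.
move=> L LD UL; exists L; split; first by move=> p /LD; rewrite inE => -[].
apply/seteqP; split=> g.
  by move=> /UL[p pL pg]; exists p.
by move=> [p /LD]; rewrite inE => -[_ +]; exact.
Qed.

Definition acts s phi psi : Prop :=
  phi (dom s) /\ forall e, psi e = phi (idem_conj s e).

Lemma acts_act s phi (sphi : phi (dom s)) : acts s phi (act sphi).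
Proof. by []. Qed.

Lemma acts_fun s phi psi psi' : acts s phi psi -> acts s phi psi' -> psi = psi'.
Proof. by move=> [_ h] [_ h']; apply: chr_ext => e; rewrite h h'. Qed.

Lemma germ_eq_conj phi s t e : germ_eq phi s t ->
  phi (idem_conj s e) = phi (idem_conj t e).
Proof.
move=> [f [pf st]].
have E r : phi (idem_conj r e) = phi (idem_conj (r * f%:S) e).
  by rewrite idem_conjM idem_conj_idem chrM pf.
by rewrite (E s) (E t) st.
Qed.

Lemma acts_eq phi psi s t : germ_eq phi s t -> acts s phi psi -> acts t phi psi.
Proof.
move=> st [sphi h]; split; first exact: germ_eq_dom st sphi.
by move=> e; rewrite h; exact: germ_eq_conj.
Qed.

Lemma conj_dom phi s e : phi (idem_conj s e) -> phi (dom s).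
Proof.
rewrite (_ : idem_conj s e = idem_mul (idem_conj s e) (dom s)).
  by rewrite chrM => /andP[].
by apply: idem_inj; rewrite /= !mulgA -(mulgA _ s) -mulgA isg_mulVK.
Qed.

Lemma acts_dom s phi psi : acts s phi psi -> psi (ran s).
Proof. by move=> [sphi ->]; rewrite idem_conj_ran. Qed.

Lemma acts_mul s t phi psi chi :
  acts t phi psi -> acts s psi chi -> acts (s * t) phi chi.
Proof.
move=> [tphi h] [spsi h']; split; first by rewrite dom_mul -h.
by move=> e; rewrite h' h idem_conjM.
Qed.

Lemma domV s : dom s^* = ran s.
Proof. by apply: idem_inj; rewrite /= isg_invK. Qed.

Lemma acts_inv s phi psi : acts s phi psi -> acts s^* psi phi.
Proof.
move=> [sphi h]; split; first by rewrite domV h idem_conj_ran.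
by move=> e; rewrite h idem_conjV chrM sphi andbT.
Qed.

Lemma idem_mulE e f : (idem_mul e f)%:S = e%:S * f%:S.
Proof. by []. Qed.

Lemma germ_eq_mul s s' t t' phi psi : acts t phi psi ->
  germ_eq phi t t' -> germ_eq psi s s' -> germ_eq phi (s * t) (s' * t').
Proof.
move=> [tphi h] [e [pe tt]] [f [pf ss]].
exists (idem_mul e (idem_conj t f)); split; first by rewrite chrM pe -h.
transitivity (s * f%:S * (t * e%:S)).
  by rewrite idem_mulE idemC [LHS]mulgA -(mulgA s) mul_conj !mulgA.
transitivity (s' * (t * e%:S * (idem_conj t f)%:S)).
  by rewrite ss -(mulgA t) idemC (mulgA t) mul_conj !mulgA.
by rewrite tt idem_mulE !mulgA.
Qed.

Lemma germ_eq_inv s t phi psi : acts s phi psi ->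
  germ_eq phi s t -> germ_eq psi s^* t^*.
Proof.
move=> [sphi h] [e [pe st]]; exists (ran (s * e%:S)); split.
  rewrite h (_ : idem_conj _ _ = idem_mul (dom s) (idem_mul e (dom s))).
    by rewrite !chrM sphi pe.
  by apply: idem_inj; rewrite /= isg_invM idem_inv !mulgA idemK.
have E r : r^* * (ran (r * e%:S))%:S = (r * e%:S)^*.
  rewrite isg_invM idem_inv /= isg_invM idem_inv !mulgA idemK.
  have := idemC (dom r) e; rewrite /= => ->.
  by rewrite -!mulgA (mulgA r^*) isg_mulKV.
by rewrite E {2}st E st.
Qed.

Lemma tgt_germ s phi (sphi : phi (dom s)) : acts s phi (tgt (germ sphi)).
Proof.
rewrite /tgt; move: (reprK (germ sphi)) (valP (repr (germ sphi))).
case: (repr _) => [[t psi] tpsi] /= E h.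
have pp : psi = phi := @germ_chr t s psi phi tpsi sphi E; subst psi.
by apply: acts_eq (acts_act h); exact/(germP tpsi sphi).
Qed.

Definition bisection (U : set groupoid) : Prop :=
  {in U &, injective src} /\ {in U &, injective tgt}.

Lemma bisectionP U : bisection U <->
  (forall s t phi, mem U s phi -> mem U t phi -> germ_eq phi s t) /\
  (forall s t phi psi chi, mem U s phi -> mem U t psi ->
     acts s phi chi -> acts t psi chi -> phi = psi /\ germ_eq phi s t).
Proof.
split=> [[Us Ut]|[Us Ut]]; split.
- move=> s t phi [sphi Usphi] [tphi Utphi]; apply/(germP sphi tphi).
  by apply: Us; rewrite ?inE // !src_germ.
- move=> s t phi psi chi [sphi Usphi] [tpsi Utpsi] sc tc.
  have E : germ sphi = germ tpsi.
    apply: Ut; rewrite ?inE //.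
    by rewrite (acts_fun (tgt_germ sphi) sc) (acts_fun (tgt_germ tpsi) tc).
  have ? := germ_chr E; subst psi; split=> //; exact/(germP sphi tpsi).
- elim/groupoid_ind=> s phi sphi; elim/groupoid_ind=> t psi tpsi.
  rewrite !inE !src_germ => /memE sU /memE tU ?; subst psi.
  by apply/germP; exact: Us.
- elim/groupoid_ind=> s phi sphi; elim/groupoid_ind=> t psi tpsi.
  rewrite !inE => /memE sU /memE tU E.
  have := Ut _ _ _ _ _ sU tU (tgt_germ sphi); rewrite E => /(_ (tgt_germ tpsi)).
  by case=> ? st; subst psi; apply/germP.
Qed.

Definition set_mul (U V : set groupoid) : set groupoid :=
  [set k | exists g h, [/\ U g, V h & germ_comp g h k]].

Definition set_inv (U : set groupoid) : set groupoid :=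
  [set k | exists g, U g /\ germ_inv g k].

Lemma mem_mul U V r phi : mem (set_mul U V) r phi <->
  exists s t psi, [/\ acts t phi psi, mem V t phi, mem U s psi &
    germ_eq phi r (s * t)].
Proof.
split=> [[rphi [g [h [Ug Vh c]]]]|[s [t [psi [ta [tphi Vt] [spsi Us] rst]]]]].
  move Ek: (germ rphi) c => k c.
  case: g h k / c Ug Vh Ek => s t psi tpsi spsi Us Vt Ek.
  have ? := germ_chr Ek; subst psi; exists s, t, (act tpsi); split=> //.
  - by exists tpsi.
  - by exists spsi.
  - exact: (germP _ _).1 Ek.
have ? := acts_fun ta (acts_act tphi); subst psi.
apply: mem_eq (germ_eq_sym rst) _; exists (comp_subproof spsi).
by exists (germ spsi), (germ tphi); split.
Qed.

Lemma mem_inv U r phi : mem (set_inv U) r phi <->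
  exists s psi, [/\ acts s psi phi, mem U s psi & germ_eq phi r s^*].
Proof.
split=> [[rphi [g [Ug c]]]|[s [psi [sa [spsi Us] rs]]]].
  move Ek: (germ rphi) c => k c.
  case: g k / c Ug Ek => s psi spsi Us Ek.
  have ? := germ_chr Ek; subst phi; exists s, psi; split=> //.
  - by exists spsi.
  - exact: (germP _ _).1 Ek.
have ? := acts_fun sa (acts_act spsi); subst phi.
apply: mem_eq (germ_eq_sym rs) _; exists (inv_subproof spsi).
by exists (germ spsi); split.
Qed.

Lemma acts_ex s phi : phi (dom s) -> exists psi, acts s phi psi.
Proof. by move=> h; exists (act h). Qed.

Lemma basic_mul s l t m :
  (forall y, y \in m -> nle y t) ->
  set_mul (basic_open s l) (basic_open t m) =
  basic_open (s * t) ([seq x * t | x <- l] ++ [seq s * y | y <- m]).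
Proof.
move=> mt; apply: mem_ext => r phi; rewrite mem_mul mem_basic.
have my psi y f : y = t * f%:S -> acts t phi psi -> psi (dom s) ->
    phi (dom (s * y)) = phi (dom y).
  move=> -> [tphi h] spsi.
  by rewrite mulgA !dom_restr !chrM dom_mul -h spsi tphi.
split=> [[s' [t' [psi [a]]]]|].
  rewrite !mem_basic => -[tphi mphi tt] [spsi lpsi ss] rst.
  have {}a' := acts_eq tt a; have [_ h] := a'; split.
  - by rewrite dom_mul -h.
  - move=> z; rewrite mem_cat => /orP[] /mapP[x xl ->{z}].
      by rewrite dom_mul -h lpsi.
    have [f xE] := mt _ xl; rewrite (my _ _ _ xE a') //.
    exact: mphi.
  - exact: germ_eq_trans rst (germ_eq_mul a tt ss).
move=> [stphi lm rst]; have tphi : phi (dom t).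
  by move: stphi; rewrite dom_mul; exact: conj_dom.
have [psi a] := acts_ex tphi; have [_ h] := a.
have spsi : psi (dom s) by rewrite h -dom_mul.
exists s, t, psi; split=> //; rewrite mem_basic; split=> //; try exact: germ_eq_refl.
  move=> y ym; have [f yE] := mt _ ym; rewrite -(my _ _ _ yE a) //.
  by apply: lm; rewrite mem_cat (map_f (fun y => s * y)) ?orbT.
move=> x xl; rewrite h -dom_mul; apply: lm.
by rewrite mem_cat (map_f (fun x => x * t)).
Qed.

Lemma basic_inv s l : (forall x, x \in l -> nle x s) ->
  set_inv (basic_open s l) = basic_open s^* [seq x^* | x <- l].
Proof.
move=> ls; apply: mem_ext => r phi; rewrite mem_inv mem_basic.
have lx psi x : acts s psi phi -> nle x s -> phi (dom x^*) = psi (dom x).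
  move=> [spsi h] [f ->]; rewrite domV h dom_restr.
  rewrite (_ : idem_conj _ _ = idem_mul (dom s) (idem_mul f (dom s))).
    by rewrite !chrM spsi.
  by apply: idem_inj; rewrite /= isg_invM idem_inv !mulgA idemK.
split=> [[s' [psi [a]]]|[sphi lphi rs]].
  rewrite mem_basic => -[spsi lpsi ss] rs'.
  have a' := acts_eq ss a; split.
  - by rewrite domV; exact: acts_dom a'.
  - by move=> _ /mapP[x xl ->]; rewrite (lx _ _ a') ?lpsi//; exact: ls.
  - exact: germ_eq_trans rs' (germ_eq_inv a ss).
have [psi /acts_inv] := acts_ex sphi; rewrite isg_invK => a; exists s, psi.
split=> //; rewrite mem_basic; split; [exact: a.1| |exact: germ_eq_refl].
by move=> x xl; rewrite -(lx _ _ a (ls _ xl)) lphi // map_f.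
Qed.

Lemma fin_basic_mul U V : fin_basic U -> fin_basic V -> fin_basic (set_mul U V).
Proof.
move=> [L [LS ->]] [M [MS ->]].
exists [seq (p.1 * q.1, [seq x * q.1 | x <- p.2] ++ [seq p.1 * y | y <- q.2])
       | p <- L, q <- M]; split.
  move=> _ /allpairsP[[p q] /= [pL qM ->]] z /=; rewrite mem_cat.
  case/orP=> /mapP[x xl ->].
    have [f ->] := LS _ pL _ xl; exists (idem_conj q.1 f).
    by rewrite -[in RHS]mulgA mul_conj !mulgA.
  by have [f ->] := MS _ qM _ xl; exists f; rewrite mulgA.
apply/seteqP; split=> g.
  move=> [h [k [[p pL ph] [q qM qk] c]]].
  eexists; first by apply/allpairsP; exists (p, q); split.
  by rewrite /= -basic_mul; [exists h, k; split|exact: MS].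
move=> [_ /allpairsP[[p q] /= [pL qM ->]]] /=.
rewrite -basic_mul; last exact: MS.
by move=> [h [k [ph qk c]]]; exists h, k; split=> //; [exists p|exists q].
Qed.

Lemma fin_basic_inv U : fin_basic U -> fin_basic (set_inv U).
Proof.
move=> [L [LS ->]]; exists [seq (p.1^*, [seq x^* | x <- p.2]) | p <- L]; split.
  move=> _ /mapP[p pL ->] _ /= /mapP[x xl ->].
  have [f ->] := LS _ pL _ xl; exists (idem_conj p.1^* f).
  by rewrite isg_invM idem_inv mul_conj.
apply/seteqP; split=> g.
  move=> [h [[p pL ph] c]].
  eexists; first by apply/mapP; exists p.
  by rewrite /= -basic_inv; [exists h|exact: LS].
move=> [_ /mapP[p pL ->]] /=; rewrite -basic_inv; last exact: LS.
by move=> [h [ph c]]; exists h; split=> //; exists p.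
Qed.

Definition compact_open_bisection (U : set groupoid) : Prop :=
  [/\ compact U, open U & bisection U].

Definition germ_unit phi s : Prop := exists e, phi e /\ s * e%:S = e%:S.

Definition all_units U : Prop := forall s phi, mem U s phi -> germ_unit phi s.

Lemma germ_unit_dom phi s : germ_unit phi s -> phi (dom s).
Proof.
move=> [e [pe /(congr1 dom)]]; rewrite dom_restr dom_idem => E.
by move: pe; rewrite -E chrM => /andP[].
Qed.

Lemma germ_unit_eq phi s t : germ_eq phi s t -> germ_unit phi s -> germ_unit phi t.
Proof.
move=> [e [pe st]] [f [pf sf]]; exists (idem_mul e f); split; first by rewrite chrM pe.
by rewrite idem_mulE mulgA -st -mulgA idemC !mulgA sf.
Qed.

Lemma units_eq phi s t : germ_unit phi s -> germ_unit phi t -> germ_eq phi s t.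
Proof.
move=> [e [pe se]] [f [pf tf]]; exists (idem_mul e f); split; first by rewrite chrM pe.
by rewrite idem_mulE mulgA se idemC mulgA tf.
Qed.

Lemma unit_acts phi s : germ_unit phi s -> acts s phi phi.
Proof.
move=> us; split; first exact: germ_unit_dom.
case: us => e [pe se] x; have : germ_eq phi s e%:S by exists e; rewrite idemE.
by move/germ_eq_conj->; rewrite idem_conj_idem chrM pe.
Qed.

Lemma acts_unit phi psi s : germ_unit phi s -> acts s phi psi -> psi = phi.
Proof. by move=> /unit_acts a b; exact: acts_fun b a. Qed.

Lemma unit_mul phi s t : germ_unit phi t -> germ_eq phi (s * t) s.
Proof. by move=> [e [pe te]]; exists e; rewrite -mulgA te. Qed.

Lemma dom_unit phi s : phi (dom s) -> germ_unit phi (dom s)%:S.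
Proof. by move=> h; exists (dom s); rewrite idemE. Qed.

Lemma all_units_bisection U : all_units U -> bisection U.
Proof.
move=> uU; apply/bisectionP; split=> [s t phi Us Ut|s t phi psi chi Us Ut sa ta].
  by apply: units_eq; apply: uU.
have E1 := acts_unit (uU _ _ Us) sa; have E2 := acts_unit (uU _ _ Ut) ta.
subst phi psi; split=> //; by apply: units_eq; apply: uU.
Qed.

Lemma set_mul_bisection U V : bisection U -> bisection V ->
  bisection (set_mul U V).
Proof.
move=> /bisectionP[Us Ut] /bisectionP[Vs Vt]; apply/bisectionP; split.
  move=> r r' phi /mem_mul[s [t [psi [a tV sU rst]]]].
  move=> /mem_mul[s' [t' [psi' [a' tV' sU' rst']]]].
  have tt := Vs _ _ _ tV tV'.
  have E := acts_fun (acts_eq tt a) a'; subst psi'.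
  apply: germ_eq_trans rst _; apply: germ_eq_trans (germ_eq_sym rst').
  exact: germ_eq_mul a tt (Us _ _ _ sU sU').
move=> r r' phi phi' chi /mem_mul[s [t [psi [a tV sU rst]]]].
move=> /mem_mul[s' [t' [psi' [a' tV' sU' rst']]]] ra ra'.
have [chi1 b] := acts_ex (mem_dom sU); have [chi2 b'] := acts_ex (mem_dom sU').
have E := acts_fun (acts_eq rst ra) (acts_mul a b); subst chi1.
have E := acts_fun (acts_eq rst' ra') (acts_mul a' b'); subst chi2.
have [E ss] := Ut _ _ _ _ _ sU sU' b b'; subst psi'.
have [E tt] := Vt _ _ _ _ _ tV tV' a a'; subst phi'; split=> //.
apply: germ_eq_trans rst _; apply: germ_eq_trans (germ_eq_sym rst').
exact: germ_eq_mul a tt ss.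
Qed.

Lemma set_inv_bisection U : bisection U -> bisection (set_inv U).
Proof.
move=> /bisectionP[Us Ut]; apply/bisectionP; split.
  move=> r r' phi /mem_inv[s [psi [a sU rs]]] /mem_inv[s' [psi' [a' sU' rs']]].
  have [E ss] := Ut _ _ _ _ _ sU sU' a a'; subst psi'.
  apply: germ_eq_trans rs _; apply: germ_eq_trans (germ_eq_sym rs').
  exact: germ_eq_inv a ss.
move=> r r' phi phi' chi /mem_inv[s [psi [a sU rs]]].
move=> /mem_inv[s' [psi' [a' sU' rs']]] ra ra'.
have E := acts_fun (acts_eq rs ra) (acts_inv a); subst chi.
have E := acts_fun (acts_eq rs' ra') (acts_inv a'); subst psi'.
have ss := Us _ _ _ sU sU'.
have E := acts_fun (acts_eq ss a) a'; subst phi'; split=> //.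
apply: germ_eq_trans rs _; apply: germ_eq_trans (germ_eq_sym rs').
exact: germ_eq_inv a ss.
Qed.

Lemma set_mul_cob U V : compact_open_bisection U -> compact_open_bisection V ->
  compact_open_bisection (set_mul U V).
Proof.
move=> [Uc Uo Ub] [Vc Vo Vb].
have [o c] : open (set_mul U V) /\ compact (set_mul U V).
  by apply/fin_basicP/fin_basic_mul; apply/fin_basicP.
by split=> //; exact: set_mul_bisection.
Qed.

Lemma set_inv_cob U : compact_open_bisection U ->
  compact_open_bisection (set_inv U).
Proof.
move=> [Uc Uo Ub].
have [o c] : open (set_inv U) /\ compact (set_inv U).
  by apply/fin_basicP/fin_basic_inv; apply/fin_basicP.
by split=> //; exact: set_inv_bisection.
Qed.

Lemma set0_cob : compact_open_bisection set0.
Proof.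
split; [exact: compact0|exact: open0|].
by apply: all_units_bisection => s phi [].
Qed.

Lemma set_mulA U V W : set_mul U (set_mul V W) = set_mul (set_mul U V) W.
Proof.
apply: mem_ext => r phi; split.
  move=> /mem_mul[a [bc [psi [abc /mem_mul[b [c [chi [ac cW bV bc_eq]]]] aU ra]]]].
  have [psi' bpsi] := acts_ex (mem_dom bV).
  have E := acts_fun (acts_eq bc_eq abc) (acts_mul ac bpsi); subst psi'.
  apply/mem_mul; exists (a * b), c, chi; split=> //.
    apply/mem_mul; exists a, b, psi; split=> //; exact: germ_eq_refl.
  apply: germ_eq_trans ra _; rewrite -mulgA.
  exact: germ_eq_mul abc bc_eq (germ_eq_refl _ _).
move=> /mem_mul[ab [c [psi [ac cW /mem_mul[a [b [chi [bpsi bV aU ab_eq]]]] ra]]]].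
apply/mem_mul; exists a, (b * c), chi; split=> //.
- exact: acts_mul ac bpsi.
- apply/mem_mul; exists b, c, psi; split=> //; exact: germ_eq_refl.
apply: germ_eq_trans ra _; rewrite mulgA.
exact: germ_eq_mul ac (germ_eq_refl _ _) ab_eq.
Qed.

Lemma set_mul0 U : set_mul set0 U = set0.
Proof. by apply/seteqP; split=> // g [h [k []]]. Qed.

Lemma set_mulr0 U : set_mul U set0 = set0.
Proof. by apply/seteqP; split=> // g [h [k []]]. Qed.

Lemma set_mul_unit U V r phi : all_units V ->
  mem (set_mul U V) r phi <-> mem U r phi /\ exists t, mem V t phi.
Proof.
move=> uV; split=> [/mem_mul[s [t [psi [a tV sU rst]]]]|[rU [t tV]]].
  have E := acts_unit (uV _ _ tV) a; subst psi; split; last by exists t.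
  apply: mem_eq sU; apply/germ_eq_sym/(germ_eq_trans rst)/unit_mul; exact: uV.
apply/mem_mul; exists r, t, phi; split=> //; first exact/unit_acts/uV.
exact/germ_eq_sym/unit_mul/uV.
Qed.

Lemma all_units_mul U V : all_units U -> all_units V ->
  set_mul U V = U `&` V.
Proof.
move=> uU uV; apply: mem_ext => r phi; rewrite set_mul_unit //.
split=> [[rU [t tV]]|[h [Ur Vr]]].
  have [h Ur] := rU; exists h; split=> //; rewrite memE.
  by apply: (mem_eq _ tV); apply: units_eq; [exact: (uV _ _ tV)|exact: (uU _ _ rU)].
by split; [exists h|exists r, h].
Qed.

Lemma idem_all_units U : bisection U -> set_mul U U = U -> all_units U.
Proof.
move=> /bisectionP[Us Ut] UU r phi rU.
have := rU; rewrite -{1}UU => /mem_mul[s [t [psi [a tU sU rst]]]].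
have rt := Us _ _ _ rU tU.
have [chi b] := acts_ex (mem_dom sU).
have ra := acts_eq (germ_eq_sym rst) (acts_mul a b).
have [E rs] := Ut _ _ _ _ _ rU sU ra b; subst psi.
have {}a := acts_eq (germ_eq_sym rt) a.
have [e [pe re]] : germ_eq phi r (r * r).
  apply: germ_eq_trans rst _; apply: germ_eq_sym.
  exact: germ_eq_mul a rt rs.
have [rphi h] := a.
have [c rc] : exists c : 'E S, r * c%:S = (dom r)%:S * r.
  by exists (idem_conj r (dom r)); rewrite mul_conj.
have dre : (dom r)%:S * e%:S = r * c%:S * e%:S.
  by rewrite rc /= -[LHS]mulgA re !mulgA.
have E : (dom r)%:S * e%:S = c%:S * e%:S * (dom r)%:S.
  transitivity ((dom r)%:S * e%:S * c%:S).
    by rewrite dre -[RHS]mulgA (idemC e c) mulgA idemK.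
  rewrite -mulgA -(idem_mulE e c) (idemC (dom r)) idem_mulE.
  by rewrite (idemC e c).
exists (idem_mul (dom r) e); split; first by rewrite chrM rphi.
rewrite idem_mulE {1}E (mulgA r) (mulgA r) -dre.
by rewrite [LHS]idemAC idemE.
Qed.

Lemma all_units_idem U : all_units U -> set_mul U U = U.
Proof. by move=> uU; rewrite all_units_mul // setIid. Qed.

Lemma mem_dom_set U r phi : bisection U -> mem (set_mul (set_inv U) U) r phi <->
  exists t, mem U t phi /\ germ_eq phi r (dom t)%:S.
Proof.
move=> /bisectionP[Us Ut].
split=> [/mem_mul[s [t [psi [a tU /mem_inv[b [chi [ba bU sb]]] rst]]]]|[t [tU rt]]].
  have [E bt] := Ut _ _ _ _ _ bU tU ba a; subst chi; exists t; split=> //.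
  apply: germ_eq_trans rst _; apply: germ_eq_mul a (germ_eq_refl _ _) _.
  exact: germ_eq_trans sb (germ_eq_inv ba bt).
have [psi a] := acts_ex (mem_dom tU).
apply/mem_mul; exists t^*, t, psi; split=> //.
apply/mem_inv; exists t, phi; split=> //; exact: germ_eq_refl.
Qed.

Lemma dom_set_units U : bisection U -> all_units (set_mul (set_inv U) U).
Proof.
move=> bU r phi /(mem_dom_set _ _ bU)[t [tU rt]].
exact: germ_unit_eq (germ_eq_sym rt) (dom_unit (mem_dom tU)).
Qed.

Lemma subset_mul U V : bisection U -> bisection V -> U `<=` V ->
  U = set_mul V (set_mul (set_inv U) U).
Proof.
move=> bU /bisectionP[Vs _] /mem_sub UV; apply: mem_ext => r phi.
rewrite set_mul_unit; last exact: dom_set_units.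
split=> [rU|[rV [t /(mem_dom_set _ _ bU)[s [sU _]]]]].
  split; first exact: UV.
  exists (dom r)%:S; apply/mem_dom_set => //; exists r.
  by split=> //; exact: germ_eq_refl.
by apply: (mem_eq _ sU); apply: Vs => //; exact: UV.
Qed.

Lemma set_mulVK U : bisection U -> set_mul (set_mul U (set_inv U)) U = U.
Proof. by move=> bU; rewrite -set_mulA -subset_mul. Qed.

Lemma set_invK U : set_inv (set_inv U) = U.
Proof.
apply: mem_ext => r phi; split=> [|rU].
  move=> /mem_inv[s [psi [a /mem_inv[t [chi [b tU st]]] rs]]].
  have E := acts_fun (acts_eq st a) (acts_inv b); subst chi.
  apply: mem_eq tU; apply: germ_eq_sym; apply: germ_eq_trans rs _.
  by have := germ_eq_inv a st; rewrite isg_invK.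
have [psi a] := acts_ex (mem_dom rU).
apply/mem_inv; exists r^*, psi; rewrite isg_invK; split.
- exact: acts_inv.
- by apply/mem_inv; exists r, phi; split=> //; exact: germ_eq_refl.
- exact: germ_eq_refl.
Qed.

Lemma open_units_diff U V : all_units U -> open U -> open V -> compact V ->
  all_units V -> open (U `\` V).
Proof.
move=> uU oU oV cV uV; have [L [LS EV]] : fin_basic V by apply/fin_basicP.
have {}uV p : p \in L -> all_units (basic_open p.1 p.2).
  move=> pL s phi ps; apply: uV; move: s phi ps; apply/mem_sub.
  by rewrite EV => g pg; exists p.
rewrite {}EV; elim: L LS uV => [|p L IH] LS uL.
  rewrite (_ : U `\` _ = U) //; apply/seteqP; split=> [g []//|g Ug].
  by split=> // -[].
rewrite (_ : U `\` _ = (U `\` basic_open p.1 p.2) `&`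
  (U `\` [set g | exists2 q, q \in L & basic_open q.1 q.2 g])); last first.
  apply/seteqP; split=> g.
    move=> [Ug nL]; split; split=> //.
      by move=> pg; apply: nL; exists p => //; rewrite mem_head.
    by move=> [q qL qg]; apply: nL; exists q => //; rewrite inE qL orbT.
  move=> [[Ug np] [_ nL]]; split=> // -[q]; rewrite inE => /orP[/eqP->//|qL qg].
  by apply: nL; exists q.
apply: openI; last first.
  apply: IH => q qL; [apply: LS|apply: uL]; by rewrite inE qL orbT.
have {uL} up := uL _ (mem_head _ _).
case: p up {LS IH L} => s l /= ul.
have loc W : (forall r phi, mem W r phi -> exists V', [/\ open V', mem V' r phi &
    V' `<=` W]) -> open W.
  move=> h; apply/openP => r phi /h[V' [oV' rV' VW]].
  have [t [m [mt rtm tV]]] := (openP V').1 oV' _ _ rV'.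
  by exists t, m; split=> //; apply: subset_trans tV VW.
apply: loc => r phi [rphi [Ur nr]]; have ur : germ_unit phi r by apply: uU; exists rphi.
have [e [pe re]] := ur.
have re' : germ_eq phi r e%:S by exists e; rewrite idemE.
have inter W : open W -> mem W r phi ->
    (forall q psi, mem W q psi -> ~ mem (basic_open s l) q psi) ->
    exists V', [/\ open V', mem V' r phi & V' `<=` U `\` basic_open s l].
  move=> oW [h Wr] hW; exists (U `&` W); split; first exact: openI.
    by exists h; split=> //; rewrite (Prop_irrelevance h rphi).
  apply/mem_sub => q psi [qpsi [Uq Wq]]; exists qpsi; split=> //.
  by rewrite memE; apply: hW; exists qpsi.
have [ps|ps] := boolP (phi (dom s)); last first.
  apply: (inter (basic_open e%:S [:: e%:S * (dom s)%:S])).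
  - by apply: open_basic => t; rewrite inE => /eqP ->; exists (dom s).
  - rewrite mem_basic dom_idem; split=> // t; rewrite inE => /eqP ->.
    by rewrite dom_restr chrM; apply/negbTE; rewrite negb_and ps.
  - move=> q psi /mem_basic[pse /(_ _ (mem_head _ _)) + _] /mem_basic[pss _ _].
    by move: pse; rewrite dom_restr dom_idem chrM pss => ->.
have [[x xl px]|nl] := pselect (exists2 x, x \in l & phi (dom x)).
  apply: (inter (basic_open (idem_mul e (dom x))%:S [::])).
  - exact: open_basic.
  - rewrite mem_basic dom_idem chrM pe px; split=> //.
    by apply: units_eq => //; exists (idem_mul e (dom x)); rewrite chrM pe px idemE.
  - move=> q psi /mem_basic[]; rewrite dom_idem chrM => /andP[_ psx] _ _.
    by move=> /mem_basic[_ /(_ _ xl)]; rewrite psx.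
exfalso; apply: nr; rewrite memE mem_basic.
have sl : mem (basic_open s l) s phi.
  rewrite mem_basic; split=> //; last exact: germ_eq_refl.
  by move=> x xl; apply/negbTE/negP => px; apply: nl; exists x.
by have /mem_basic[? ? _] := sl; split=> //; apply: units_eq => //; exact: ul.
Qed.

Lemma diff_cob U V : all_units U -> all_units V -> compact_open_bisection U ->
  compact_open_bisection V -> compact_open_bisection (U `\` V).
Proof.
move=> uU uV [Uc Uo Ub] [Vc Vo Vb]; split.
- by rewrite setDE; apply: compact_closedI => //; exact: open_closedC.
- exact: open_units_diff.
- by apply: all_units_bisection => s phi [h [Us _]]; apply: uU; exists h.
Qed.

Lemma compat_unitsr U V s t phi : all_units (set_mul U (set_inv V)) ->
  mem U s phi -> mem V t phi -> germ_eq phi s t.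
Proof.
move=> uUV sU tV; have [psi a] := acts_ex (mem_dom tV).
have [e [pe se]] : germ_unit psi (s * t^*).
  apply: uUV; apply/mem_mul; exists s, t^*, phi; split=> //.
  - exact: acts_inv.
  - by apply/mem_inv; exists t, phi; split=> //; exact: germ_eq_refl.
  - exact: germ_eq_refl.
have [_ h] := a; exists (idem_conj t e); split; first by rewrite -h.
by rewrite mul_conj /= !mulgA se.
Qed.

Lemma compat_unitsl U V s t phi psi chi : all_units (set_mul (set_inv U) V) ->
  mem U s psi -> mem V t phi -> acts s psi chi -> acts t phi chi ->
  psi = phi /\ germ_eq psi s t.
Proof.
move=> uUV sU tV sa ta; have ust : germ_unit phi (s^* * t).
  apply: uUV; apply/mem_mul; exists s^*, t, chi; split=> //.
    by apply/mem_inv; exists s, psi; split=> //; exact: germ_eq_refl.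
  exact: germ_eq_refl.
have E := acts_unit ust (acts_mul ta (acts_inv sa)); subst psi; split=> //.
have [e [pe se]] := ust.
have [q [pq tq]] : exists q, phi q /\ t * q%:S = (ran s)%:S * t.
  exists (idem_conj t (ran s)); rewrite mul_conj; split=> //.
  by have [_ h] := ta; rewrite -h; exact: acts_dom sa.
exists (idem_mul e q); split; first by rewrite chrM pe.
have sE : s * e%:S = t * q%:S * e%:S by rewrite tq -{1}se /= !mulgA.
by rewrite idem_mulE (mulgA s) sE (mulgA t) [LHS]idemAC idemK idemAC.
Qed.

Lemma compat_union_bisection U V : bisection U -> bisection V ->
  all_units (set_mul (set_inv U) V) -> all_units (set_mul U (set_inv V)) ->
  bisection (U `|` V).
Proof.
move=> /bisectionP[Us Ut] /bisectionP[Vs Vt] ul ur.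
have UV s phi : mem (U `|` V) s phi -> mem U s phi \/ mem V s phi.
  by move=> [h [Uh|Vh]]; [left|right]; exists h.
apply/bisectionP; split=> [s t phi /UV[sU|sV] /UV[tU|tV]|s t phi psi chi].
- exact: Us.
- exact: compat_unitsr ur sU tV.
- exact/germ_eq_sym/(compat_unitsr ur tU sV).
- exact: Vs.
move=> /UV[sU|sV] /UV[tU|tV] sa ta.
- exact: Ut sU tU sa ta.
- exact: compat_unitsl ul sU tV sa ta.
- have [E ts] := compat_unitsl ul tU sV ta sa; subst psi.
  by split=> //; exact: germ_eq_sym.
- exact: Vt sV tV sa ta.
Qed.

Lemma union_cob U V : compact_open_bisection U -> compact_open_bisection V ->
  bisection (U `|` V) -> compact_open_bisection (U `|` V).
Proof.
move=> [Uc Uo _] [Vc Vo _] b; split=> //; [|exact: openU].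
by apply: compactU.
Qed.

Lemma basic_bisection s : bisection (basic_open s [::]).
Proof.
apply/bisectionP; split.
  move=> a b phi /mem_basic[_ _ as_] /mem_basic[_ _ bs].
  exact: germ_eq_trans as_ (germ_eq_sym bs).
move=> a b phi psi chi /mem_basic[_ _ as_] /mem_basic[_ _ bs] aa ba.
have {}aa := acts_inv (acts_eq as_ aa); have {}ba := acts_inv (acts_eq bs ba).
have E := acts_fun aa ba; subst psi; split=> //.
exact: germ_eq_trans as_ (germ_eq_sym bs).
Qed.

End Groupoid.

Record BX (S : invSemigroupType) (X : set ('E S * {fset 'E S})) := Bisection {
  bis_set :> set (groupoid X);
  bisP : compact_open_bisection bis_set
}.

Section BXInstances.
Context {S : invSemigroupType} (X : set ('E S * {fset 'E S})).

HB.instance Definition _ := gen_eqMixin (BX X).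
HB.instance Definition _ := gen_choiceMixin (BX X).

Lemma BX_ext (U V : BX X) : bis_set U = V -> U = V.
Proof.
case: U V => [U Up] [V Vp] /= E; subst V.
by rewrite (Prop_irrelevance Up Vp).
Qed.

Lemma BX_bisection (U : BX X) : bisection U.
Proof. by case: (bisP U). Qed.

Definition BX_mul (U V : BX X) : BX X :=
  Bisection (set_mul_cob (bisP U) (bisP V)).

Definition BX_inv (U : BX X) : BX X := Bisection (set_inv_cob (bisP U)).

Definition BX_zero : BX X := Bisection (set0_cob X).

Lemma BX_mulA : associative BX_mul.
Proof. by move=> U V W; apply: BX_ext; exact: set_mulA. Qed.

HB.instance Definition _ := isSemigroup.Build (BX X) BX_mulA.

Lemma BX_mulE (U V : BX X) : bis_set (U * V) = set_mul U V.
Proof. by []. Qed.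

Lemma BX_mul0 U : BX_zero * U = BX_zero.
Proof. by apply: BX_ext; exact: set_mul0. Qed.

Lemma BX_mulr0 U : U * BX_zero = BX_zero.
Proof. by apply: BX_ext; exact: set_mulr0. Qed.

Lemma BX_mulVK (U : BX X) : U * BX_inv U * U = U.
Proof. by apply: BX_ext; exact/set_mulVK/BX_bisection. Qed.

Lemma BX_invK (U : BX X) : BX_inv (BX_inv U) = U.
Proof. by apply: BX_ext; exact: set_invK. Qed.

Lemma BX_mulKV (U : BX X) : BX_inv U * U * BX_inv U = BX_inv U.
Proof. by have := BX_mulVK (BX_inv U); rewrite BX_invK. Qed.

Lemma BX_idem_units (U : BX X) : U * U = U <-> all_units U.
Proof.
split=> [/(congr1 (@bis_set _ _))|uU].
  by apply: idem_all_units; exact: BX_bisection.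
by apply: BX_ext; exact: all_units_idem.
Qed.

Lemma BX_idemC (U V : BX X) : U * U = U -> V * V = V -> U * V = V * U.
Proof.
move=> /BX_idem_units uU /BX_idem_units uV; apply: BX_ext.
by rewrite !BX_mulE !all_units_mul // setIC.
Qed.

Lemma BX_inv_uniq (U V : BX X) : U * V * U = U -> V * U * V = V -> V = BX_inv U.
Proof.
move=> UVU VUV; set W := BX_inv U.
have UWU : U * W * U = U by exact: BX_mulVK.
have WUW : W * U * W = W by exact: BX_mulKV.
transitivity (V * U * W).
  have C : U * V * (U * W) = U * W * (U * V).
    by apply: BX_idemC; rewrite mulgA ?UVU ?UWU.
  rewrite -{1}VUV -{1}UWU.
  transitivity (V * (U * W * (U * V))); first by rewrite !mulgA.
  by rewrite -C !mulgA VUV.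
have C : W * U * (V * U) = V * U * (W * U).
  by apply: BX_idemC; rewrite mulgA ?WUW ?VUV.
rewrite -[RHS]WUW -{2}UVU.
transitivity (V * U * (W * U) * W); first by rewrite -[in LHS]WUW !mulgA.
by rewrite -C !mulgA.
Qed.

HB.instance Definition _ := Semigroup_isInverse.Build (BX X)
  BX_mul0 BX_mulr0 BX_mulVK BX_mulKV BX_inv_uniq.

Lemma BX_idemP (E : 'E (BX X)) : all_units E%:S.
Proof. exact/BX_idem_units/idemE. Qed.

Lemma BX_nleP (U V : BX X) : nle U V <-> (U : set _) `<=` V.
Proof.
split=> [[E ->]|UV].
  apply/mem_sub => r phi; rewrite BX_mulE set_mul_unit; last exact: BX_idemP.
  by case.
exists (dom U); apply: BX_ext.
by apply: subset_mul => //; exact: BX_bisection.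
Qed.

Lemma BX_unit_subproof (U : BX X) : all_units U -> U * U == U.
Proof. by move=> uU; apply/eqP/BX_idem_units. Qed.

Lemma all_unitsU (U V : set (groupoid X)) :
  all_units U -> all_units V -> all_units (U `|` V).
Proof.
by move=> uU uV s phi [h [Uh|Vh]]; [apply: uU|apply: uV]; exists h.
Qed.

Lemma all_unitsD (U V : set (groupoid X)) : all_units U -> all_units (U `\` V).
Proof. by move=> uU s phi [h [Uh _]]; apply: uU; exists h. Qed.

Definition BX_idemU (E F : 'E (BX X)) : 'E (BX X) :=
  Idem (@BX_unit_subproof (Bisection (union_cob (bisP E%:S) (bisP F%:S)
      (all_units_bisection (all_unitsU (@BX_idemP E) (@BX_idemP F)))))
    (all_unitsU (@BX_idemP E) (@BX_idemP F))).

Definition BX_idemD (E F : 'E (BX X)) : 'E (BX X) :=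
  Idem (@BX_unit_subproof (Bisection (diff_cob (@BX_idemP E) (@BX_idemP F)
      (bisP E%:S) (bisP F%:S))) (all_unitsD (@BX_idemP E))).

Lemma BX_idem_joinP (E F G : 'E (BX X)) :
  idem_join E F G <-> bis_set G%:S = bis_set E%:S `|` F%:S.
Proof.
have joinU : idem_join E F (BX_idemU E F).
  split; first by apply/BX_nleP => g; left.
    by apply/BX_nleP => g; right.
  by move=> H /BX_nleP EH /BX_nleP FH; apply/BX_nleP => g [/EH|/FH].
have [jE jF jm] := joinU; split=> [[hE hF hm]|EG].
  apply/seteqP; split; first by have /BX_nleP := hm _ jE jF.
  by have /BX_nleP := jm _ hE hF.
suff -> : G = BX_idemU E F by [].
by apply: idem_inj; apply: BX_ext.
Qed.

Lemma BX_idemI (E F : 'E (BX X)) :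
  bis_set (idem_mul E F)%:S = bis_set E%:S `&` F%:S.
Proof. by rewrite BX_mulE all_units_mul //; exact: BX_idemP. Qed.

Lemma BX_idem_boolean : @idem_boolean (BX X).
Proof.
split=> [E F|E F G H|E F G].
- by exists (BX_idemU E F); apply/BX_idem_joinP.
- move=> /BX_idem_joinP h; apply/BX_idem_joinP.
  by rewrite !BX_idemI h setIUr.
move=> /BX_nleP EF /BX_nleP FG.
exists (BX_idemU E (BX_idemD G F)); split.
  apply: idem_inj; apply: BX_ext; rewrite BX_idemI /=.
  apply/seteqP; split=> g; first by move=> [Fg [//|[]]].
  by move=> Eg; split; [exact: EF|left].
apply/BX_idem_joinP; apply/seteqP; split=> g /=.
  by move=> Gg; have [Fg|nFg] := pselect (bis_set F%:S g); [left|right; right].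
by move=> [/FG//|[/EF/FG//|[]]].
Qed.

Lemma BX_join_ex (U V : BX X) : compatible U V -> exists W, is_join U V W.
Proof.
move=> [/BX_idem_units ul /BX_idem_units ur].
have b := compat_union_bisection (BX_bisection U) (BX_bisection V) ul ur.
exists (Bisection (union_cob (bisP U) (bisP V) b)); split.
- by apply/BX_nleP => g; left.
- by apply/BX_nleP => g; right.
- by move=> W /BX_nleP UW /BX_nleP VW; apply/BX_nleP => g [/UW|/VW].
Qed.

HB.instance Definition _ := InverseSemigroup_isBoolean.Build (BX X)
  BX_idem_boolean BX_join_ex.

Lemma iota_subproof (s : S) : compact_open_bisection
  [set g : groupoid X | exists (phi : character X) (sphi : phi (dom s)), g = germ sphi].
Proof.
rewrite (_ : [set _ | _] = basic_open s [::]).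
  split; [exact: compact_basic|exact: open_basic|exact: basic_bisection].
apply/seteqP; split=> g [phi [sphi]]; first by move=> ->; exists phi, sphi.
by move=> [-> _]; exists phi, sphi.
Qed.

Definition BX_iota (s : S) : BX X := Bisection (iota_subproof s).

End BXInstances.

(* Each finite set is enumerated by the canonical enumeration of its elements;
   the order is irrelevant, since by [BX_rel_mul] the e_i are sent to pairwise
   compatible elements. *)
Inductive BX_rel (S : invSemigroupType) (X : set ('E S * {fset 'E S})) :
    term S -> term S -> Prop :=
  | BX_rel0 : BX_rel X (Gen 0) TZero
  | BX_rel_mul s t : BX_rel X (Gen (s * t)) (TMul (Gen s) (Gen t))
  | BX_relX e (F : {fset 'E S}) : X (e, F) ->
      BX_rel X (Gen e%:S) (\big[@TNabla S/TZero]_(f <- F) Gen f%:S).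

(* Main.v *)
From mathcomp Require Import all_boot finmap.
From mathcomp Require Import boolp classical_sets.
Require Import Defs.

(** The content of the presentation is its universal property: a map [f] from
[S] to a Boolean inverse semigroup [B] that satisfies the relations extends to
a homomorphism on the compact-open bisections.  The extension is read off germ
by germ.

A Boolean character of [B], i.e. a character of E(B) that preserves binary
joins, pulls back along [f] to a character of E(S), unless its pullback is
zero; the relations [BX_relX], transported by the action of [S], ensure that
the pullback respects [conj_closure X] ([conj_closure_map]).  Thus each germ [s, psi] of the
groupoid of [S] at a pulled-back character [psi] determines the germ of [f s]
at the Boolean character [phi] above it.  Say that [b] in [B] corresponds to
the bisection [U] when the germs of [b] at Boolean characters are exactly those
obtained in this way from the germs that belong to [U] ([germwise]).

This relation holds between [f s] and the bisection of [s], and it is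
compatible with all the operations, since each of them can be computed on
germs; hence it holds between the values in [B] and in B_X(S) of any term over
[S] ([germwise_eval]).  Every compact-open bisection is the value of a term
([BX_generated]): it is a finite union of basic sets, and both the basic sets
and the union can be written with the extended signature.  So each bisection
corresponds to some [b].  This [b] is unique because the germs of an element at
Boolean characters determine it ([germ_eq_separates]), a consequence of the
prime ideal theorem in E(B).  Being the graph of a map and compatible with the
operations, the relation is the wanted homomorphism; generation by terms makes
the homomorphism unique.

Boolean characters of [B] are the characters of E(B) relative to the set of
relations e = e1 \/ e2 valid in E(B), so that germs, the partial action and the
groupoid of [B] itself are instances of the same construction as for [S]. *)

Set Implicit Arguments.
Unset Strict Implicit.
Unset Printing Implicit Defensive.

Local Open Scope classical_set_scope.
Local Open Scope group_scope.
Local Open Scope isg_scope.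

(** * Natural order and joins *)

Section Order.
Context {S : invSemigroupType}.
Implicit Types (a b c : S) (e f g : 'E S).

Lemma idem_mulC e f : idem_mul e f = idem_mul f e.
Proof. by apply: idem_inj; exact: idemC. Qed.

Lemma idem_mulA e f g : idem_mul e (idem_mul f g) = idem_mul (idem_mul e f) g.
Proof. by apply: idem_inj; exact: mulgA. Qed.

Lemma idem_mulI e : idem_mul e e = e.
Proof. by apply: idem_inj; exact: idemE. Qed.

Lemma idem_mul0 e : idem_mul e idem0 = idem0.
Proof. by apply: idem_inj; exact: isg_mulr0. Qed.

Lemma idem_leP e f : nle e%:S f%:S <-> idem_mul f e = e.
Proof.
split=> [[g E]|E]; last by exists e; rewrite -{1}E.
by apply: idem_inj; rewrite idem_mulE E mulgA idemE.
Qed.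

Lemma nle_idemM e f : nle (idem_mul e f)%:S e%:S.
Proof. by exists f. Qed.

Lemma nle_trans a b c : nle a b -> nle b c -> nle a c.
Proof. by move=> [e ->] [f ->]; exists (idem_mul f e); rewrite idem_mulE mulgA. Qed.

Lemma nleE a b : nle a b -> a = b * (dom a)%:S.
Proof. by move=> [e ->]; rewrite dom_restr idem_mulE idemC mulgA mul_dom. Qed.

Lemma nle_anti a b : nle a b -> nle b a -> a = b.
Proof.
move=> ab ba; rewrite (nleE ab) {1}(nleE ba) [LHS]idemAC.
by rewrite mul_dom -(nleE ba).
Qed.

Lemma nle_dom a b : nle a b -> nle (dom a)%:S (dom b)%:S.
Proof. by move=> [e ->]; rewrite dom_restr; exists e; exact: idemC. Qed.

Lemma is_join_uniq a b c d : is_join a b c -> is_join a b d -> c = d.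
Proof.
move=> [ac bc cm] [ad bd dm]; apply: nle_anti; [exact: cm|exact: dm].
Qed.

Lemma idem_joinC e f g : idem_join e f g -> idem_join f e g.
Proof. by move=> [eg fg gm]; split=> // h fh eh; exact: gm. Qed.

Lemma nle_dom_eq a b : nle a b -> nle (dom b)%:S (dom a)%:S -> a = b.
Proof.
by move=> ab ba; rewrite (nleE ab) (nle_anti (nle_dom ab) ba) mul_dom.
Qed.

Lemma bounded_compatible a b c : nle a c -> nle b c -> compatible a b.
Proof.
move=> [e ->] [f ->]; split; rewrite /is_idem.
  have -> : (c * e%:S)^* * (c * f%:S) = (idem_mul e (idem_mul (dom c) f))%:S.
    by rewrite isg_invM idem_inv /= !mulgA.
  exact: idemE.
have -> : c * e%:S * (c * f%:S)^* = (idem_conj c^* (idem_mul e f))%:S.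
  by rewrite isg_invM idem_inv /= isg_invK !mulgA.
exact: idemE.
Qed.

(** Conjugation by [s] is an isomorphism between the idempotents below [ran s]
and those below [dom s], so that it preserves joins below [ran s]; outside this
range it first multiplies by [ran s]. *)
Lemma idem_join_conj s e f g (r := idem_mul (ran s)) :
  idem_join (r e) (r f) (r g) ->
  idem_join (idem_conj s e) (idem_conj s f) (idem_conj s g).
Proof.
have rK x : idem_conj s (r x) = idem_conj s x.
  rewrite idem_conj_mul idem_conj_ran; apply: idem_inj.
  by rewrite /= !mulgA isg_mulKV.
have mono x y : nle x%:S y%:S -> nle (idem_conj s x)%:S (idem_conj s y)%:S.
  by move=> /idem_leP xy; apply/idem_leP; rewrite -idem_conj_mul xy.
have up x h : nle (idem_conj s x)%:S h%:S -> nle (r x)%:S (idem_conj s^* h)%:S.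
  move=> /idem_leP xh; apply/idem_leP.
  have E : r x = idem_conj s^* (idem_conj s x).
    have := @idem_conjV _ s^* x; rewrite isg_invK domV => ->.
    exact: idem_mulC.
  by rewrite E -idem_conj_mul xh.
move=> [eg fg gm]; split; rewrite -?(rK e) -?(rK f) -?(rK g); try exact: mono.
move=> h; rewrite !rK => /up eh /up fh.
have /mono := gm _ eh fh; rewrite rK idem_conjV => gh.
exact: nle_trans gh (nle_idemM _ _).
Qed.

End Order.

Section BooleanJoins.
Context {B : boolInvSemigroupType}.
Implicit Types (a b c s : B) (e f g : 'E B).

(** Below a fixed [c], an element is determined by its domain, and
[h |-> c * h] inverts [dom]: so joins of elements with a common upper bound can
be computed on the domains.  This is the bridge from the Boolean algebra of
idempotents to arbitrary elements. *)
Lemma is_join_dom a b c : is_join a b c -> idem_join (dom a) (dom b) (dom c).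
Proof.
move=> [ac bc cm]; split; [exact: nle_dom|exact: nle_dom|move=> h ah bh].
have up x : nle x c -> nle (dom x)%:S h%:S -> nle x (c * h%:S).
  move=> xc [k xh]; exists k; rewrite -mulgA -xh; exact: nleE.
have := nle_dom (cm _ (up _ ac ah) (up _ bc bh)).
by rewrite dom_restr => /nle_trans; apply; exact: nle_idemM.
Qed.

Lemma dom_is_join a b c : nle a c -> nle b c ->
  idem_join (dom a) (dom b) (dom c) -> is_join a b c.
Proof.
move=> ac bc [_ _ cm]; have [j jJ] := bis_join_ex _ _ (bounded_compatible ac bc).
have [aj bj jm] := jJ.
by have <- // : j = c; apply: nle_dom_eq; [exact: jm|apply: cm; exact: nle_dom].
Qed.

Lemma idem_join_is_join e f g : idem_join e f g -> is_join e%:S f%:S g%:S.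
Proof.
by move=> h; have [eg fg _] := h; apply: dom_is_join => //; rewrite !dom_idem.
Qed.

(** Multiplication distributes over joins because, on the domains, it is the
distributive law of the Boolean algebra of idempotents. *)
Lemma is_join_restr b e f g : idem_join e f g ->
  is_join (b * e%:S) (b * f%:S) (b * g%:S).
Proof.
move=> h; have [/idem_leP eg /idem_leP fg _] := h.
apply: dom_is_join.
- by exists e; rewrite -mulgA -idem_mulE eg.
- by exists f; rewrite -mulgA -idem_mulE fg.
by rewrite !dom_restr !(idem_mulC _ (dom b)); exact: (idem_distr bis_idem_boolean).
Qed.

Lemma conj_idem_join s e f g : idem_join e f g ->
  idem_join (idem_conj s e) (idem_conj s f) (idem_conj s g).
Proof. by move=> h; apply: idem_join_conj; exact: (idem_distr bis_idem_boolean). Qed.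

Lemma bis_joinP a b : compatible a b -> is_join a b (bis_join a b).
Proof. by move=> /bis_join_ex h; exact: xgetPex. Qed.

Lemma idem_diffP e f : idem_mul (idem_diff e f) (idem_mul e f) = idem0 /\
  idem_join (idem_diff e f) (idem_mul e f) e.
Proof.
apply: (@xgetPex _ idem0 [set g | idem_mul g (idem_mul e f) = idem0 /\
  idem_join g (idem_mul e f) e]).
have z : nle idem0%:S (idem_mul e f)%:S by apply/idem_leP; exact: idem_mul0.
have [g [g0 /idem_joinC gJ]] := idem_compl bis_idem_boolean z (nle_idemM e f).
by exists g; split=> //; rewrite idem_mulC.
Qed.

Lemma idem_diff_le e f : nle (idem_diff e f)%:S e%:S.
Proof. by have [_ []] := idem_diffP e f. Qed.

Lemma idem_diff_mul0 e f : (idem_diff e f)%:S * f%:S = 0.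
Proof.
have [E _] := idem_diffP e f; have /idem_leP h := idem_diff_le e f.
by rewrite -{1}h (idem_mulC e) -idem_mulE -idem_mulA E.
Qed.

Lemma bis_diff_idem e f : bis_diff e%:S f%:S = (idem_diff e f)%:S.
Proof.
have R x : ran x%:S = x :> 'E B by apply: idem_inj; rewrite /= idem_inv idemE.
have /idem_leP h := idem_diff_le e f.
rewrite /bis_diff !R !dom_idem -!idem_mulE; congr (_ %:S).
by rewrite -idem_mulA h idem_mulI.
Qed.

Lemma bis_diff_le b c : nle (bis_diff b c) b.
Proof. by rewrite /bis_diff -mul_conj -mulgA -idem_mulE; eexists; reflexivity. Qed.

(** Both products in the definition of compatibility vanish: [bis_diff b c] has
domain and range disjoint from those of [c]. *)
Lemma bis_diff_compatible b c : compatible (bis_diff b c) c.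
Proof.
split; rewrite /is_idem.
  suff -> : (bis_diff b c)^* * c = 0 by rewrite isg_mul0.
  rewrite /bis_diff !isg_invM !idem_inv -!mulgA.
  have -> : (idem_diff (ran b) (ran c))%:S * c = 0; last by rewrite !isg_mulr0.
  rewrite -{2}(isg_mulVK c) mulgA -[c * c^*]/((ran c)%:S) idem_diff_mul0.
  exact: isg_mul0.
suff -> : bis_diff b c * c^* = 0 by rewrite isg_mul0.
rewrite /bis_diff -mulgA.
have -> : (idem_diff (dom b) (dom c))%:S * c^* = 0; last by rewrite isg_mulr0.
rewrite -(isg_mulKV c) mulgA -[c^* * c]/((dom c)%:S) idem_diff_mul0.
exact: isg_mul0.
Qed.

Lemma bis_nablaP b c : is_join (bis_diff b c) c (bis_nabla b c).
Proof. exact/bis_joinP/bis_diff_compatible. Qed.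

Lemma bis_nabla_idem e f :
  exists2 g, idem_join e f g & bis_nabla e%:S f%:S = g%:S.
Proof.
have [g gJ] := idem_join_ex bis_idem_boolean e f; exists g => //.
apply: is_join_uniq (bis_nablaP _ _) _; rewrite bis_diff_idem.
apply: idem_join_is_join; have [eg fg gm] := gJ; have [_ [de ee em]] := idem_diffP e f.
split=> //; first exact: nle_trans de eg.
move=> h dh fh; apply: gm => //; apply: em => //; apply: nle_trans fh.
by rewrite idem_mulC; exact: nle_idemM.
Qed.

End BooleanJoins.

(** * Boolean characters separate the elements of a Boolean inverse semigroup *)

Section PrimeIdeals.
Context {B : boolInvSemigroupType}.
Implicit Types (e f g : 'E B).

Definition idem_ideal (I : set ('E B)) : Prop :=
  [/\ I idem0, forall e f, I e -> I (idem_mul e f) &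
      forall e f g, I e -> I f -> idem_join e f g -> I g].

(** The ideal generated by [I] and [x], i.e. the [e] below [i \/ x] for some
[i] in [I]; quantifying over the upper bounds of [i] and [x] avoids having to
choose their join. *)
Definition ideal_adjoin (I : set ('E B)) (x : 'E B) : set ('E B) :=
  [set e | exists2 i, I i &
     forall u, nle i%:S u%:S -> nle x%:S u%:S -> nle e%:S u%:S].

Lemma ideal_adjoin_ideal I x : idem_ideal I -> idem_ideal (ideal_adjoin I x).
Proof.
move=> [I0 IM IJ]; split.
- by exists idem0.
- move=> e f [i Ii h]; exists i => // u iu xu.
  exact: nle_trans (nle_idemM _ _) (h _ iu xu).
- move=> e f g [i Ii h] [j Ij k] [_ _ gm].
  have [m mJ] := idem_join_ex bis_idem_boolean i j.
  have [im jm _] := mJ; exists m; first exact: IJ mJ.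
  by move=> u mu xu; apply: gm; [apply: h|apply: k] => //; apply: nle_trans mu.
Qed.

Lemma maximal_ideal (I : set ('E B)) e : idem_ideal I -> ~ I e ->
  exists M, [/\ idem_ideal M, I `<=` M, ~ M e &
    forall J, idem_ideal J -> M `<=` J -> ~ J e -> J `<=` M].
Proof.
move=> Iid nIe.
(* Zorn's lemma is applied to the J such that I `|` J is a suitable ideal, and
   not to the J that contain I, so that the union of the empty chain qualifies. *)
have [F FP tF|A [[Aid nAe] Amax]] := @Zorn_bigcup _
    [set J | idem_ideal (I `|` J) /\ ~ (I `|` J) e].
  have [[J0 FJ0]|nF] := pselect (exists J, F J); last first.
    rewrite (_ : \bigcup_(J in F) J = set0); first by rewrite /= setU0; split=> // -[].
    by apply/seteqP; split=> // x [J FJ _]; apply: nF; exists J.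
  have inF x : (I `|` \bigcup_(J in F) J) x <-> exists2 J, F J & (I `|` J) x.
    split=> [[Ix|[J FJ Jx]]|[J FJ [Ix|Jx]]].
    - by exists J0 => //; left.
    - by exists J => //; right.
    - by left.
    - by right; exists J.
  split; last by move=> /inF[J /FP[_ +]].
  split.
  - by left; case: Iid.
  - move=> x y /inF[J FJ Jx]; apply/inF; exists J => //.
    by have [[_ h _] _] := FP _ FJ; exact: h.
  move=> x y z /inF[J FJ Jx] /inF[K FK Ky] xyz; apply/inF.
  have [JK|KJ] := tF _ _ FJ FK.
    exists K => //; have [[_ _ h] _] := FP _ FK; apply: h xyz => //.
    by move: Jx => [?|/JK ?]; [left|right].
  exists J => //; have [[_ _ h] _] := FP _ FJ; apply: h xyz => //.
  by move: Ky => [?|/KJ ?]; [left|right].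
exists (I `|` A); split=> // J Jid AJ nJe x Jx.
apply: contrapT => nAx; apply: (Amax J).
  split; first by move=> y Ay; apply: AJ; right.
  by move=> /(_ _ Jx) Ax; apply: nAx; right.
have IJ : I `<=` J by move=> y Iy; apply: AJ; left.
split; first by have /setUidPr -> := IJ.
by move=> [/IJ|].
Qed.

(** If neither [x] nor [y] is in [M], then by maximality [e] is below [n \/ x]
and below [n \/ y] for a common [n] in [M], hence, by distributivity, below
[n \/ (x y)], which would be in [M] with [x y]. *)
Lemma maximal_ideal_prime M e : idem_ideal M -> ~ M e ->
  (forall J, idem_ideal J -> M `<=` J -> ~ J e -> J `<=` M) ->
  forall x y, M (idem_mul x y) -> M x \/ M y.
Proof.
move=> Mid nMe Mmax x y Mxy; have [M0 MM MJ] := Mid.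
have MD f g : M g -> nle f%:S g%:S -> M f.
  by move=> Mg /idem_leP <-; exact: MM.
have adj z : ~ M z -> ideal_adjoin M z e.
  move=> nMz; apply: contrapT => nJ; apply: nMz.
  apply: (Mmax _ (ideal_adjoin_ideal z Mid)) => //.
  - by move=> i Mi; exists i.
  - by exists idem0.
apply: contrapT => /not_orP[/adj[i Mi hi] /adj[j Mj hj]]; apply: nMe.
have [n nJ] := idem_join_ex bis_idem_boolean i j; have Mn := MJ _ _ _ Mi Mj nJ.
have [g gJ] := idem_join_ex bis_idem_boolean n x.
have [h hJ] := idem_join_ex bis_idem_boolean n y.
have [[iN jN _] [ng xg _] [nh yh _]] := And3 nJ gJ hJ.
have /idem_leP eg : nle e%:S g%:S by apply: hi => //; apply: nle_trans ng.
have /idem_leP eh : nle e%:S h%:S by apply: hj => //; apply: nle_trans nh.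
rewrite -eg -eh idem_mulA; apply: (MM).
apply: (MJ _ _ _ _ _ (idem_distr bis_idem_boolean g hJ)).
  by rewrite idem_mulC; exact: MM.
rewrite idem_mulC.
apply: (MJ _ _ _ _ _ (idem_distr bis_idem_boolean y gJ)).
  by rewrite idem_mulC; exact: MM.
by rewrite idem_mulC.
Qed.

End PrimeIdeals.

(** The joins that hold in E(B), as a set of relations: the characters relative
to it are the characters of the Boolean algebra E(B). *)
Definition binary_joins (B : boolInvSemigroupType) : set ('E B * {fset 'E B}) :=
  [set p | exists e f, idem_join e f p.1 /\ p.2 = [fset e; f]%fset].
Arguments binary_joins : clear implicits.

Notation boolean_character B := (character (binary_joins B)).

Section BooleanCharacters.
Context {B : boolInvSemigroupType}.
Implicit Types (b c : B) (e f g : 'E B) (phi : boolean_character B).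

Lemma chr_join phi e f g : idem_join e f g -> phi g = phi e || phi f.
Proof.
move=> h; rewrite (@chrX _ _ phi g [fset e; f]%fset); last first.
  by apply: conj_closure_base; exists e, f.
rewrite big_has; apply/hasP/orP => [[x + px]|[px|px]].
- by rewrite !inE => /orP[] /eqP <-; [left|right].
- by exists e; rewrite // !inE eqxx.
- by exists f; rewrite // !inE eqxx orbT.
Qed.

(** Conjugation preserves joins, so this set of relations is already closed
under it. *)
Lemma conj_closure_binary_joins e (F : {fset 'E B}) :
  conj_closure (binary_joins B) e F -> binary_joins B (e, F).
Proof.
elim=> // s {}e {}F _ [f [g [/= J ->]]]; exists (idem_conj s f), (idem_conj s g).
split; first exact: conj_idem_join.
exact: imfset_fset2.
Qed.

(** The complement of a prime ideal, seen as a map to the booleans, is a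
Boolean character. *)
Lemma boolean_prime_ideal (I : set ('E B)) e : idem_ideal I -> ~ I e ->
  exists phi, phi e /\ forall i, I i -> phi i = false.
Proof.
move=> Iid nIe; have [M [Mid IM nMe Mmax]] := maximal_ideal Iid nIe.
have Mprime := maximal_ideal_prime Mid nMe Mmax; have [M0 MM MJ] := Mid.
pose p x := ~~ `[< M x >].
have pE x : p x = false <-> M x.
  by split=> [/negbFE/asboolP|/asboolP h] //; rewrite /p h.
have p_neq0 : exists x, p x by exists e; apply/negP => /asboolP.
have p0 : p idem0 = false by apply/pE.
have pM x y : p (idem_mul x y) = p x && p y.
  apply/negb_inj; rewrite negb_and !negbK; apply/asboolP/orP.
    by move=> /Mprime[]; [left|right]; exact/asboolP.
  by move=> [] /asboolP h; [|rewrite idem_mulC]; exact: MM.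
have pX x (F : {fset 'E B}) : conj_closure (binary_joins B) x F ->
    p x = \big[orb/false]_(f <- F) p f.
  move=> /conj_closure_binary_joins[f [g [/= J ->]]]; rewrite big_has.
  have [fx gx _] := J; apply/idP/hasP => [px|[y + py]].
    have [pf|/negbTE/pE Mf] := boolP (p f); first by exists f; rewrite // !inE eqxx.
    have [pg|/negbTE/pE Mg] := boolP (p g).
      by exists g; rewrite // !inE eqxx orbT.
    by have /pE := MJ _ _ _ Mf Mg J; rewrite px.
  rewrite !inE => yE; have /idem_leP yx : nle y%:S x%:S.
    by move: yE => /orP[] /eqP ->.
  by move: py; rewrite -yx pM => /andP[].
exists (Character p_neq0 p0 pM pX); split; first by apply/negP => /asboolP.
by move=> i /IM/pE.
Qed.

(** The [e] such that [b] and [c] agree on [e] form an ideal; if [dom b] were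
not in it, some Boolean character would be 1 at [dom b] and 0 on this ideal,
against the equality of the germs of [b] and [c] there. *)
Lemma germ_eq_separates b c :
  (forall phi, phi (dom b) -> germ_eq phi b c) -> nle b c.
Proof.
move=> h; pose I : set ('E B) := [set e | b * e%:S = c * e%:S].
have Iid : idem_ideal I.
  split; first by rewrite /I /= !isg_mulr0.
    by move=> e f; rewrite /I /= !mulgA => ->.
  move=> e f g Ie If J; apply: is_join_uniq (is_join_restr b J) _.
  by rewrite Ie If; exact: is_join_restr.
have [Ib|nIb] := pselect (I (dom b)); first by exists (dom b); rewrite -Ib mul_dom.
have [phi [pb pI]] := boolean_prime_ideal Iid nIb.
by have [e [pe /pI]] := h _ pb; rewrite pe.
Qed.

Lemma chr_idem_diff phi e f : phi (idem_diff e f) = phi e && ~~ phi f.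
Proof.
have [E J] := idem_diffP e f; rewrite (chr_join phi J) chrM.
have := chr0 phi; rewrite -E !chrM (chr_join phi J) chrM.
by case: (phi _); case: (phi e) => //; case: (phi f).
Qed.

End BooleanCharacters.

(** * The extended signature on compact-open bisections *)

Section BooleanBisections.
Context {S : invSemigroupType} {X : set ('E S * {fset 'E S})}.
Implicit Types (U V W : BX X) (E F G : 'E (BX X)) (s t r : S) (e f : 'E S).

Lemma bisection_sub (P Q : set (groupoid X)) :
  P `<=` Q -> bisection Q -> bisection P.
Proof.
move=> PQ [i j]; split=> g h; rewrite !inE => Pg Ph.
  by apply: i; rewrite inE; exact: PQ.
by apply: j; rewrite inE; exact: PQ.
Qed.

Lemma BX_is_joinE U V W : is_join U V W -> bis_set W = bis_set U `|` V.
Proof.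
move=> [/BX_nleP UW /BX_nleP VW Wm]; have UVW : bis_set U `|` V `<=` W.
  by move=> g [/UW|/VW].
apply/seteqP; split=> //.
pose UV := Bisection (union_cob (bisP U) (bisP V)
  (bisection_sub UVW (BX_bisection W))).
have /BX_nleP : nle W UV by apply: Wm; apply/BX_nleP => g; [left|right].
exact.
Qed.

Lemma BX_idem_diffE E F : bis_set (idem_diff E F)%:S = bis_set E%:S `\` F%:S.
Proof.
have [/(congr1 (fun H : 'E (BX X) => bis_set H%:S)) + /BX_idem_joinP] := idem_diffP E F.
rewrite !BX_idemI => D0 DE; apply/seteqP; split=> g.
  move=> Dg; have Eg : bis_set E%:S g by rewrite DE; left.
  split=> // Fg; have : bis_set (@idem0 (BX X))%:S g by rewrite -D0.
  by [].
by move=> [+ nFg]; rewrite {1}DE => -[|[]].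
Qed.

(** A germ of [U] outside [V] shares neither its source nor its target with a
germ of [V], since the union is a bisection; so removing the domain and range
of [V] from [U] removes only the germs of [V]. *)
Lemma BX_nablaE U V : bisection (bis_set U `|` V) ->
  bis_set (bis_nabla U V) = bis_set U `|` V.
Proof.
move=> /bisectionP[bs bt]; rewrite (BX_is_joinE (bis_nablaP U V)).
have /BX_nleP dU := bis_diff_le U V.
apply/seteqP; split=> g [Ug|Vg]; [by left; exact: dU|by right| |by right].
have [Vg|nVg] := pselect (bis_set V g); first by right.
left; move: Ug nVg; elim/(@groupoid_ind S X): g => r phi rphi.
rewrite !memE => rU nrV; have inU s psi : mem U s psi -> mem (bis_set U `|` V) s psi.
  by apply: (mem_sub _ _).2 => ?; left.
have inV s psi : mem V s psi -> mem (bis_set U `|` V) s psi.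
  by apply: (mem_sub _ _).2 => ?; right.
have diffI E F s psi : mem E%:S s psi -> ~ mem F%:S s psi ->
    mem (idem_diff E F)%:S s psi.
  rewrite BX_idem_diffE => -[h Es] nF; exists h; split=> // Fs.
  by apply: nF; exists h.
rewrite /bis_diff; apply/set_mul_unit; first exact: BX_idemP.
have [psi a] := acts_ex rphi; split.
  apply/mem_mul; exists (ran r)%:S, r, psi; split=> //; last first.
    by rewrite /= isg_mulVK; exact: germ_eq_refl.
  rewrite -!domV; apply: diffI.
    apply/mem_dom_set; first exact: BX_bisection (U^*).
    exists r^*; split; last exact: germ_eq_refl.
    by apply/mem_inv; exists r, phi; split=> //; exact: germ_eq_refl.
  move=> /(mem_dom_set _ _ (BX_bisection (V^*)))[t [/mem_inv[s [chi [sa sV _]]] _]].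
  have [E rs] := bt _ _ _ _ _ (inU _ _ rU) (inV _ _ sV) a sa; subst chi.
  exact/nrV/(mem_eq (germ_eq_sym rs)).
exists (dom r)%:S; apply: diffI.
  apply/mem_dom_set; first exact: BX_bisection.
  by exists r; split=> //; exact: germ_eq_refl.
move=> /(mem_dom_set _ _ (BX_bisection V))[t [tV _]].
exact/nrV/(mem_eq (bs _ _ _ (inV _ _ tV) (inU _ _ rU))).
Qed.

Lemma mem_iota s r phi : mem (BX_iota X s) r phi <->
  phi (dom s) /\ germ_eq phi r s.
Proof.
split=> [[rphi [psi [spsi E]]]|[sphi rs]].
  by have ? := germ_chr E; subst psi; split=> //; exact: (germP _ _).1 E.
by apply: mem_eq (germ_eq_sym rs) _; exists sphi, phi, sphi.
Qed.

Lemma BX_iotaE s : bis_set (BX_iota X s) = basic_open s [::].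
Proof.
apply: mem_ext => r phi; rewrite mem_iota mem_basic.
by split=> [[]|[]].
Qed.

Lemma BX_iotaM s t : BX_iota X (s * t) = BX_iota X s * BX_iota X t.
Proof. by apply: BX_ext; rewrite BX_mulE !BX_iotaE basic_mul. Qed.

End BooleanBisections.

Section IdempotentMap.
Context {S : invSemigroupType} {B : boolInvSemigroupType} (f : S -> B).
Hypothesis fM : forall s t, f (s * t) = f s * f t.

Lemma idem_map_subproof (e : 'E S) : f e%:S * f e%:S == f e%:S.
Proof. by rewrite -fM idemE. Qed.

Definition idem_map (e : 'E S) : 'E B := Idem (idem_map_subproof e).

End IdempotentMap.

(** * Generation *)

Section Generation.
Context {S : invSemigroupType} {X : set ('E S * {fset 'E S})}.
Notation iotaE := (idem_map (@BX_iotaM S X)).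

Lemma mem_iota_idem (e : 'E S) r (phi : character X) :
  mem (iotaE e)%:S r phi <-> phi e /\ germ_eq phi r e%:S.
Proof. by have := mem_iota e%:S r phi; rewrite dom_idem. Qed.

Lemma mem_iota_idem_self (e : 'E S) (phi : character X) :
  mem (iotaE e)%:S e%:S phi <-> phi e.
Proof.
rewrite mem_iota_idem; split=> [[]//|pe]; split=> //; exact: germ_eq_refl.
Qed.

(** The germs of [s] at the characters that vanish at [dom x] are cut out by
multiplying on the right with [dom s \ dom x]. *)
Lemma basic_open_generated s (l : seq S) :
  exists u, bis_set (eval (BX_iota X) u) = basic_open s l.
Proof.
elim: l => [|x l [u uE]]; first by exists (Gen s); exact: BX_iotaE.
exists (TMul u (TDiff (Gen (dom s)%:S) (Gen (dom x)%:S))).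
have D : bis_diff (BX_iota X (dom s)%:S) (BX_iota X (dom x)%:S) =
  (idem_diff (iotaE (dom s)) (iotaE (dom x)))%:S.
  exact: (bis_diff_idem (iotaE (dom s)) (iotaE (dom x))).
rewrite -[eval _ _]/(eval (BX_iota X) u *
  bis_diff (BX_iota X (dom s)%:S) (BX_iota X (dom x)%:S)) D.
apply: mem_ext => r phi; rewrite BX_mulE set_mul_unit; last exact: BX_idemP.
rewrite uE !mem_basic BX_idem_diffE.
split=> [[[sphi lphi rs] [t [tphi [sx nx]]]]|[sphi lphi rs]].
  split=> // y; rewrite inE => /orP[/eqP->|/lphi//].
  move: sx nx; rewrite !memE => /mem_iota_idem[_ te] nx.
  apply/negbTE/negP => px; apply: nx; apply/mem_iota_idem; split=> //.
  apply: germ_eq_trans te _; apply: units_eq; exact: dom_unit.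
have /mem_iota_idem_self[h sh] := sphi.
split; first by split=> // y yl; apply: lphi; rewrite inE yl orbT.
exists (dom s)%:S, h; split=> //; rewrite memE => /mem_iota_idem[].
by rewrite lphi // mem_head.
Qed.

(** By compactness a bisection is a finite union of basic sets; the partial
unions are bisections, so [TNabla] expresses each of them. *)
Lemma BX_generated (U : BX X) : exists u, eval (BX_iota X) u = U.
Proof.
have [Uc Uo Ub] := bisP U; have [L [_ UL]] := (fin_basicP U).2 (conj Uo Uc).
suff [u uE] : exists u, bis_set (eval (BX_iota X) u) = U.
  by exists u; exact: BX_ext.
rewrite UL in Ub *; elim: L Ub {UL} => [|p L IH] b.
  by exists TZero; apply/seteqP; split=> // g [].
have [u uE] := basic_open_generated p.1 p.2.
have [|v vE] := IH.
  apply: bisection_sub b => g [q qL qg]; exists q => //.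
  by rewrite inE qL orbT.
have E : [set g | exists2 q, q \in p :: L & basic_open q.1 q.2 g] =
    bis_set (eval (BX_iota X) u) `|` eval (BX_iota X) v.
  rewrite uE vE; apply/seteqP; split=> g.
    by move=> [q]; rewrite inE => /orP[/eqP->|qL] qg; [left|right; exists q].
  move=> [pg|[q qL qg]]; first by exists p => //; exact: mem_head.
  by exists q => //; rewrite inE qL orbT.
by exists (TNabla u v); rewrite E /= BX_nablaE // -E.
Qed.

End Generation.

(** * The relations *)

Section Relations.
Context {S : invSemigroupType} (X : set ('E S * {fset 'E S})).

(** On commuting idempotents the iterated [bis_nabla] is the finite join.  The
join [j] is described through an arbitrary property that is compatible with
binary joins: this covers both being 1 at a given Boolean character and
containing a given germ. *)
Lemma big_nabla_idem (B : boolInvSemigroupType) (f : S -> B)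
    (fM : forall s t, f (s * t) = f s * f t) (l : seq ('E S)) :
  exists2 j : 'E B,
    eval f (\big[@TNabla S/TZero]_(e <- l) Gen e%:S) = j%:S &
    forall P : set ('E B), ~ P idem0 ->
      (forall e g h, idem_join e g h -> P h <-> P e \/ P g) ->
      P j <-> exists2 e, e \in l & P (idem_map fM e).
Proof.
elim: l => [|x l [j jE jP]].
  by exists idem0 => [|P P0 _]; [rewrite big_nil|split=> [/P0|[]]].
have [g gJ gE] := bis_nabla_idem (idem_map fM x) j.
exists g => [|P P0 PJ]; first by rewrite big_cons /= jE.
rewrite (PJ _ _ _ gJ) (jP P) //; split=> [[Px|[e el Pe]]|[e]].
- by exists x => //; exact: mem_head.
- by exists e => //; rewrite inE el orbT.
- by rewrite inE => /orP[/eqP->|el] Pe; [left|right; exists e].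
Qed.

Lemma BX_iota_satisfies : satisfies (BX_rel X) (BX_iota X).
Proof.
move=> _ _ [|s t|e K XeK]; [|exact: BX_iotaM|].
  apply: BX_ext; apply: mem_ext => r phi; rewrite mem_iota.
  have -> : dom (0 : S) = idem0 by exact: dom_idem idem0.
  by rewrite chr0; split=> [[]|[]].
have [j -> jP] := big_nabla_idem (@BX_iotaM S X) K.
have iotaE : eval (BX_iota X) (Gen e%:S) = (idem_map (@BX_iotaM S X) e)%:S by [].
apply: BX_ext; apply: mem_ext => r phi; rewrite iotaE mem_iota_idem.
have := chrX phi (conj_closure_base XeK); rewrite big_has => eK.
have -> : mem j%:S r phi <->
    exists2 k, k \in (K : seq _) & mem (idem_map (@BX_iotaM S X) k)%:S r phi.
  apply: (jP (fun E => mem E%:S r phi)) => [[]//|E F G /BX_idem_joinP ->].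
  by split=> [[h [Eh|Fh]]|[[h Eh]|[h Fh]]];
    [left; exists h|right; exists h|exists h; left|exists h; right].
have unit (x : 'E S) : phi x -> germ_unit phi x%:S by exists x; rewrite idemE.
split=> [[pe re]|[k kK /mem_iota_idem[pk rk]]].
  have := pe; rewrite eK => /hasP[k kK pk]; exists k => //.
  apply/mem_iota_idem; split=> //; apply: germ_eq_trans re _.
  by apply: units_eq; exact: unit.
have pe : phi e by rewrite eK; apply/hasP; exists k.
by split=> //; apply: germ_eq_trans rk _; apply: units_eq; exact: unit.
Qed.

End Relations.

(** * The universal property *)

Section UniversalProperty.
Context {S : invSemigroupType} {X : set ('E S * {fset 'E S})}.
Context {B : boolInvSemigroupType} {f : S -> B}.
Hypothesis fR : satisfies (BX_rel X) f.
Implicit Types (s t : S) (e : 'E S) (b c : B) (U V W : BX X).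
Implicit Types (phi : boolean_character B) (psi : character X).

Let f0 : f 0 = 0.
Proof. exact: fR (BX_rel0 X). Qed.

Let fM s t : f (s * t) = f s * f t.
Proof. exact: fR (BX_rel_mul X s t). Qed.

Let fV s : f s^* = (f s)^*.
Proof. by apply: isg_inv_uniq; rewrite -!fM ?isg_mulVK ?isg_mulKV. Qed.

Notation F := (idem_map fM).

Let F_dom s : dom (f s) = F (dom s).
Proof. by apply: idem_inj; rewrite /= fM fV. Qed.

Let F_conj s e : F (idem_conj s e) = idem_conj (f s) (F e).
Proof. by apply: idem_inj; rewrite /= !fM fV. Qed.

Definition pulls_back phi psi : Prop := forall e, psi e = phi (F e).

(** For the pairs of [X] this is the relation [BX_relX].  Conjugating by [s] replaces
[phi] by its image under [f s], if defined, and otherwise makes both sides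
vanish; this is why the induction is on a statement about all [phi]. *)
Lemma conj_closure_map e (K : {fset 'E S}) : conj_closure X e K ->
  forall phi, phi (F e) = has (fun k => phi (F k)) K.
Proof.
elim=> {e K} [e K XeK phi|s e K _ IH phi].
  have [j jE jP] := big_nabla_idem fM K.
  have -> : F e = j by apply: idem_inj; rewrite -jE; exact: fR (BX_relX XeK).
  have jK : phi j <-> exists2 k, k \in (K : seq _) & phi (F k).
    apply: (jP (fun x => phi x)) => [|x y z /(chr_join phi) ->]; first by rewrite chr0.
    by split=> /orP.
  by apply/idP/hasP => /jK.
have hasE : has (fun k => phi (F k)) [fset idem_conj s k | k in K]%fset =
    has (fun k => phi (F (idem_conj s k))) K.
  apply/hasP/hasP => [[_ /imfsetP[k /= kK ->] pk]|[k kK pk]]; first by exists k.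
  by exists (idem_conj s k) => //; apply/imfsetP; exists k.
rewrite hasE; have [/acts_ex[phi' [_ a]]|ns] := boolP (phi (dom (f s))).
  by rewrite F_conj -a IH; apply: eq_has => k; rewrite F_conj a.
have z k : phi (F (idem_conj s k)) = false.
  by rewrite F_conj; apply/negbTE/negP => /conj_dom; exact/negP.
by rewrite z; apply/esym/negbTE/hasPn => k _; rewrite z.
Qed.

Lemma pulls_back_ex phi e : phi (F e) -> exists psi, pulls_back phi psi.
Proof.
move=> pe; pose p x := phi (F x).
have p_neq0 : exists x, p x by exists e.
have p0 : p idem0 = false.
  have F0 : F idem0 = idem0 by apply: idem_inj; exact: f0.
  by rewrite /p F0 chr0.
have pM x y : p (idem_mul x y) = p x && p y.
  by rewrite -chrM; congr (phi _); apply: idem_inj; exact: fM.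
have pX x (K : {fset 'E S}) : conj_closure X x K ->
    p x = \big[orb/false]_(k <- K) p k.
  by move=> xK; rewrite big_has; exact: conj_closure_map.
by exists (Character p_neq0 p0 pM pX).
Qed.

Lemma pulls_back_acts phi psi psi' s : pulls_back phi psi -> acts s psi psi' ->
  exists2 phi', acts (f s) phi phi' & pulls_back phi' psi'.
Proof.
move=> pp [sd sa].
have [phi' a] : exists phi', acts (f s) phi phi' by apply: acts_ex; rewrite F_dom -pp.
by exists phi' => // e; have [_ a'] := a; rewrite sa a' pp F_conj.
Qed.

Lemma pulls_back_acts_ex phi phi' psi s : pulls_back phi psi -> psi (dom s) ->
  acts (f s) phi phi' -> exists2 psi', acts s psi psi' & pulls_back phi' psi'.
Proof.
move=> pp /acts_ex[psi' a] a'; exists psi' => //.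
by have [phi2 /(acts_fun a') <-] := pulls_back_acts pp a.
Qed.

(** The map induced by [f] on germs, from the point [psi] to the point [phi]
above it. *)
Lemma germ_eq_map phi psi s t : pulls_back phi psi -> germ_eq psi s t ->
  germ_eq phi (f s) (f t).
Proof.
by move=> pp [e [pe st]]; exists (F e); rewrite -pp /= -!fM st.
Qed.

(** The graph of the homomorphism that extends [f], expressed on germs: over
each Boolean character, the germs of [b] are the images of those of [U]. *)
Definition germwise b U : Prop :=
  (forall phi, phi (dom b) -> exists psi s, pulls_back phi psi /\ mem U s psi) /\
  (forall phi psi s, pulls_back phi psi -> mem U s psi -> germ_eq phi b (f s)).

Lemma germwise_dom b U phi psi s : germwise b U -> pulls_back phi psi ->
  mem U s psi -> phi (dom b).
Proof.
move=> [_ bU] pp sU; apply: germ_eq_dom (germ_eq_sym (bU _ _ _ pp sU)) _.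
by rewrite F_dom -pp; exact: mem_dom sU.
Qed.

Lemma germwise_inj b c U : germwise b U -> germwise c U -> b = c.
Proof.
suff le x y : germwise x U -> germwise y U -> nle x y.
  by move=> bU cU; apply: nle_anti; exact: le.
move=> xU yU; apply: germ_eq_separates => phi /xU.1[psi [s [pp sU]]].
apply: germ_eq_trans (xU.2 _ _ _ pp sU) _; apply: germ_eq_sym.
exact: yU.2 pp sU.
Qed.

Lemma germwise_gen s : germwise (f s) (BX_iota X s).
Proof.
split=> [phi|phi psi t pp /mem_iota[_ ts]]; last first.
  by apply: germ_eq_sym; exact: germ_eq_map pp ts.
rewrite F_dom => ps; have [psi pp] := pulls_back_ex ps.
exists psi, s; split=> //; apply/mem_iota; split; first by rewrite pp.
exact: germ_eq_refl.
Qed.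

Lemma germwise0 : germwise 0 0.
Proof.
split=> [phi|phi psi s _ []//].
have -> : dom (0 : B) = idem0 by exact: dom_idem idem0.
by rewrite chr0.
Qed.

Lemma germwiseV b U : germwise b U -> germwise b^* U^*.
Proof.
move=> bU; split=> [phi|phi psi t pp /mem_inv[s [chi [a sU ts]]]].
  move=> /acts_ex[phi' a]; have := acts_inv a; rewrite isg_invK => a'.
  have [psi' [s [pp sU]]] := bU.1 _ a'.1.
  have sa := acts_eq (bU.2 _ _ _ pp sU) a'.
  have [psi pa pp'] := pulls_back_acts_ex pp (mem_dom sU) sa.
  exists psi, s^*; split=> //; apply/mem_inv; exists s, psi'.
  by split=> //; exact: germ_eq_refl.
have [phi' a' pp'] := pulls_back_acts pp (acts_inv a).
have := acts_inv a'; rewrite fV isg_invK => fa.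
have bs := bU.2 _ _ _ pp' sU.
apply: germ_eq_trans (germ_eq_inv (acts_eq (germ_eq_sym bs) fa) bs) _.
by rewrite -fV; apply: germ_eq_sym; exact: germ_eq_map pp ts.
Qed.

Lemma germwiseM b c U V : germwise b U -> germwise c V ->
  germwise (b * c) (U * V).
Proof.
move=> bU cV; split=> [phi|phi psi r pp /mem_mul[s [t [chi [a tV sU rst]]]]].
  rewrite dom_mul => bc; have pc := conj_dom bc.
  have [psi [t [pp tV]]] := cV.1 _ pc; have ct := cV.2 _ _ _ pp tV.
  have [phi' a] := acts_ex pc.
  have [psi' ta pp'] := pulls_back_acts_ex pp (mem_dom tV) (acts_eq ct a).
  have [|psi2 [s [pp2 sU]]] := bU.1 phi'; first by rewrite a.2.
  have E : psi2 = psi' by apply: chr_ext => e; rewrite pp2 pp'.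
  subst psi2; exists psi, (s * t); split=> //.
  by apply/mem_mul; exists s, t, psi'; split=> //; exact: germ_eq_refl.
have [phi' a' pp'] := pulls_back_acts pp a; have ct := cV.2 _ _ _ pp tV.
have bs := bU.2 _ _ _ pp' sU.
apply: germ_eq_trans (germ_eq_mul (acts_eq (germ_eq_sym ct) a') ct bs) _.
by rewrite -fM; apply: germ_eq_sym; exact: germ_eq_map pp rst.
Qed.

Lemma germwise_idem_diff (x y : 'E B) (G H : 'E (BX X)) :
  germwise x%:S G%:S -> germwise y%:S H%:S ->
  germwise (idem_diff x y)%:S (idem_diff G H)%:S.
Proof.
move=> xG yH; split=> [phi|phi psi s pp].
  rewrite dom_idem chr_idem_diff => /andP[px npy].
  have [|psi [s [pp [h sG]]]] := xG.1 phi; first by rewrite dom_idem.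
  exists psi, s; split=> //; exists h; rewrite BX_idem_diffE; split=> //.
  rewrite memE => sH; have := germwise_dom yH pp sH.
  by rewrite dom_idem; exact/negP.
rewrite BX_idem_diffE => -[h [sG nH]].
have {}sG : mem G%:S s psi by exists h.
have px := germwise_dom xG pp sG; rewrite dom_idem in px.
have npy : phi y = false.
  apply/negP => py; have [|chi [t [pp' tH]]] := yH.1 phi; first by rewrite dom_idem.
  have E : chi = psi by apply: chr_ext => e; rewrite pp pp'.
  subst chi; apply: nH; apply/memE/(mem_eq _ tH)/units_eq.
    exact: BX_idemP tH.
  exact: BX_idemP sG.
apply: germ_eq_trans (xG.2 _ _ _ pp sG).
have pd : phi (idem_diff x y) by rewrite chr_idem_diff px npy.
exists (idem_diff x y); split=> //; rewrite idemE.
by have /idem_leP/(congr1 (@idem_val B)) := idem_diff_le x y.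
Qed.

Lemma germwise_dom_idem b U : germwise b U -> germwise (dom b)%:S (dom U)%:S.
Proof. by move=> bU; apply: germwiseM (germwiseV bU) bU. Qed.

Lemma germwise_ran_idem b U : germwise b U -> germwise (ran b)%:S (ran U)%:S.
Proof. by move=> bU; apply: germwiseM bU (germwiseV bU). Qed.

Lemma germwiseD b c U V : germwise b U -> germwise c V ->
  germwise (bis_diff b c) (bis_diff U V).
Proof.
move=> bU cV; rewrite /bis_diff; apply: germwiseM; first apply: germwiseM => //.
  by apply: germwise_idem_diff; exact: germwise_ran_idem.
by apply: germwise_idem_diff; exact: germwise_dom_idem.
Qed.

(** A Boolean character which is 1 at the domain of the join is 1 at the domain
of [b] or of [c], and the join has the same germ as [b] or [c] there. *)
Lemma germwise_join b c d U V W : germwise b U -> germwise c V ->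
  is_join b c d -> is_join U V W -> germwise d W.
Proof.
move=> bU cV dJ /BX_is_joinE WE; have [bd cd _] := dJ; split=> [phi|phi psi s pp].
  rewrite (chr_join phi (is_join_dom dJ)) => /orP[/bU.1|/cV.1] [psi [s [pp [h sW]]]].
    by exists psi, s; split=> //; exists h; rewrite WE; left.
  by exists psi, s; split=> //; exists h; rewrite WE; right.
have le x Z : germwise x Z -> nle x d -> mem Z s psi -> germ_eq phi d (f s).
  move=> xZ xd sZ; apply: germ_eq_trans (xZ.2 _ _ _ pp sZ).
  exists (dom x); split; first exact: germwise_dom xZ pp sZ.
  by rewrite -(nleE xd) mul_dom.
by rewrite WE => -[h [Us|Vs]]; [apply: le bU bd _|apply: le cV cd _]; exists h.
Qed.

Lemma germwiseN b c U V : germwise b U -> germwise c V ->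
  germwise (bis_nabla b c) (bis_nabla U V).
Proof.
move=> bU cV.
exact: germwise_join (germwiseD bU cV) cV (bis_nablaP _ _) (bis_nablaP _ _).
Qed.

Lemma germwise_eval u : germwise (eval f u) (eval (BX_iota X) u).
Proof.
elim: u => [s||u|u bU v cV|u bU v cV|u bU v cV] /=.
- exact: germwise_gen.
- exact: germwise0.
- exact: germwiseV.
- exact: germwiseM.
- exact: germwiseD.
- exact: germwiseN.
Qed.

Lemma BX_universal :
  exists! h : BX X -> B, bis_hom h /\ forall s, h (BX_iota X s) = f s.
Proof.
have /choice[h hP] U : exists b, germwise b U.
  by have [u <-] := BX_generated U; exists (eval f u); exact: germwise_eval.
have hE b U : germwise b U -> h U = b by exact: germwise_inj.
exists h; split.
  split; last by move=> s; apply: hE; exact: germwise_gen.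
  split=> *; apply: hE.
  - exact: germwise0.
  - exact: germwiseV.
  - exact: germwiseM.
  - exact: germwiseD.
  - exact: germwiseN.
move=> k [[k0 kV kM kD kN] ki]; apply/funext => U.
have [u <-] := BX_generated U; rewrite (hE _ _ (germwise_eval u)).
elim: u => [s||u IH|u IHu v IHv|u IHu v IHv|u IHu v IHv] /=.
- by rewrite ki.
- by rewrite k0.
- by rewrite kV IH.
- by rewrite kM IHu IHv.
- by rewrite kD IHu IHv.
- by rewrite kN IHu IHv.
Qed.

End UniversalProperty.

Theorem proposition5p3 (S : invSemigroupType) (X : set ('E S * {fset 'E S})) :
  presented_by (BX_rel X) (BX_iota X).
Proof.
split; [exact: BX_iota_satisfies|exact: BX_generated|].
by move=> B f; exact: BX_universal.
Qed.
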